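(* Let $K\in\mathcal R$ be a connected linearly ordered space. Then $K$ is order isomorphic to one of the following spaces: $1$, $[0,1]$, $\mathrm{R}^{\rightarrow}+1$, $(\mathrm{R}^{\rightarrow}+1)^{-1}$, ${}^{\leftarrow}\mathrm{I}^{\rightarrow}$. In particular, $K$ is Valdivia compact.
   Context: All spaces are completely regular Hausdorff; maps are continuous; linearly ordered spaces are nonempty and carry the order topology. A retraction is a map $f\colon X\to Y$ having a right inverse, i.e. a continuous $g\colon Y\to X$ with $fg=\mathrm{id}_Y$. An inverse sequence is an inverse system $\mathbb S=\langle X_\xi,p_\xi^\eta,\lambda\rangle$ indexed by an ordinal $\lambda$. It is continuous if for every limit ordinal $\delta<\lambda$ the space $X_\delta$ together with the maps $p_\xi^\delta$ ($\xi<\delta$) is the inverse limit of $\mathbb S\restriction\delta$. $\mathcal R$ is the smallest class of compact spaces which contains all metrizable compact spaces and is closed under limits of continuous inverse sequences whose bonding maps are retractions. A compact space $X$ is Valdivia compact if for some $\kappa$ there is an embedding $X\subseteq[0,1]^\kappa$ such that $X=\operatorname{cl}(X\cap\Sigma(\kappa))$, where $\Sigma(\kappa)=\{x\in[0,1]^\kappa: |\{\alpha<\kappa: x(\alpha)\neq 0\}|\le\aleph_0\}$. Order notation: $1$ is the one-point linear order; $X+Y$ is the ordered sum (all of $X$ below all of $Y$); $X^{-1}$ is $X$ with the reversed order. The long ray $\mathrm{R}^{\rightarrow}$ is the set $\omega_1\times[0,1)$ ordered by $(\alpha,s)<(\beta,t)$ iff $\alpha<\beta$, or $\alpha=\beta$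 and $s<t$ (that is, $\omega_1$ consecutive copies of $[0,1)$). The long interval ${}^{\leftarrow}\mathrm{I}^{\rightarrow}$ is the unique (up to order isomorphism) linearly ordered space $[a,b]$, with least element $a$ and greatest element $b$, such that for every $p\in(a,b)$ the interval $[p,b]$ is order isomorphic to $\mathrm{R}^{\rightarrow}+1$ and the interval $[a,p]$ is order isomorphic to $(\mathrm{R}^{\rightarrow}+1)^{-1}$. *)

(* Defs.v *)
From HB Require Import structures.
From mathcomp Require Import all_boot all_order all_algebra.
From mathcomp Require Import all_classical wochoice all_reals topology metric_structure function_spaces.

Set Implicit Arguments.
Unset Strict Implicit.
Unset Printing Implicit Defensive.

Import Order.TTheory GRing.Theory Num.Theory.
Import numFieldTopology.Exports.

Local Open Scope classical_set_scope.
Local Open Scope order_scope.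

(* Subsets of a linear order, seen as types, carry the induced order. *)
HB.instance Definition _ d (T : orderType d) (A : set T) :=
  [Order of set_type A by <:].

Definition order_iso d (T : orderType d) d' (T' : orderType d') : Prop :=
  exists f : T -> T', bijective f /\ {mono f : x y / x <= y}.

(* The ordered sum X + Y: all of X below all of Y. *)
Fact osum_display : Order.disp_t. Proof. exact: (Order.Disp tt tt). Qed.

Definition osum (T T' : Type) : Type := (T + T')%type.
HB.instance Definition _ (T T' : choiceType) := Choice.on (osum T T').

Section OrderedSum.
Context d (T : orderType d) d' (T' : orderType d').

Definition osum_le (u v : osum T T') : bool :=
  match u, v with
  | inl x, inl y => x <= y
  | inl _, inr _ => true
  | inr _, inl _ => false
  | inr x, inr y => x <= y
  end.

Fact osum_le_refl : reflexive osum_le.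
Proof. by case=> x /=. Qed.

Fact osum_le_anti : antisymmetric osum_le.
Proof. by case=> x [] y //= /le_anti ->. Qed.

Fact osum_le_trans : transitive osum_le.
Proof. by case=> y [] x [] z //=; exact: le_trans. Qed.

Fact osum_le_total : total osum_le.
Proof. by case=> x [] y //=; exact: le_total. Qed.

HB.instance Definition _ := Order.Le_isPOrder.Build osum_display (osum T T')
  osum_le_refl osum_le_anti osum_le_trans.
HB.instance Definition _ := Order.POrder_isTotal.Build osum_display (osum T T')
  osum_le_total.

End OrderedSum.

(* An uncountable type, with a well-order given by the axiom of choice. *)
Fact wo_display : Order.disp_t. Proof. exact: (Order.Disp tt tt). Qed.

Definition wo_carrier : Type := nat -> bool.
HB.instance Definition _ := Choice.copy wo_carrier (nat -> bool).

Definition wo_le : rel wo_carrier := sval (well_ordering_principle wo_carrier).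

Fact wo_leP : well_order wo_le.
Proof. exact: svalP (well_ordering_principle wo_carrier). Qed.

Fact wo_le_refl : reflexive wo_le.
Proof.
by move=> x; apply: (wo_chain_reflexive (C := predT) (withinW wo_leP)).
Qed.

Fact wo_le_anti : antisymmetric wo_le.
Proof.
by move=> x y; apply: (wo_chain_antisymmetric (C := predT) (withinW wo_leP)).
Qed.

Fact wo_le_total : total wo_le.
Proof. by move=> x y; apply: (wo_chainW (C := predT) (withinW wo_leP)). Qed.

Fact wo_le_trans : transitive wo_le.
Proof.
move=> y x z xy yz.
have [m [[]]] : exists! m, minimum_of wo_le (mem [:: x; y; z]) m.
  by apply: wo_leP; exists x; rewrite !inE eqxx.
move=> + lem _; rewrite !inE => /or3P[] /eqP me.
- by rewrite -{1}me; apply: lem; rewrite !inE eqxx !orbT.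
- have /wo_le_anti -> // : wo_le x y && wo_le y x.
  by rewrite xy -{1}me lem// !inE eqxx.
- have /wo_le_anti <- // : wo_le y z && wo_le z y.
  by rewrite yz -{1}me lem// !inE eqxx !orbT.
Qed.

HB.instance Definition _ := Order.Le_isPOrder.Build wo_display wo_carrier
  wo_le_refl wo_le_anti wo_le_trans.
HB.instance Definition _ := Order.POrder_isTotal.Build wo_display wo_carrier
  wo_le_total.

(* The first uncountable ordinal: the shortest uncountable initial segment of
   the well-order above; see omega1_well_order, omega1_countable_below and
   omega1_uncountable. *)
Definition omega1 := set_type [set w : wo_carrier | countable `]-oo, w[].

Fact omega1_well_order : well_order (<=%O : rel omega1).
Proof.
apply: antisymmetric_well_order => [x y /le_anti//|A [a Aa]].
pose B : {pred wo_carrier} := fun w => `[< exists2 x, x \in A & w = val x >].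
have [w [[/asboolP[x Ax ->] lex] _]] : exists! w, minimum_of wo_le B w.
  by apply: wo_leP; exists (val a); apply/asboolP; exists a.
by exists x; split=> // y Ay; apply: lex; apply/asboolP; exists y.
Qed.

Fact omega1_countable_below (x : omega1) : countable `]-oo, x[.
Proof.
have /set_mem/countable_injP[f finj] := valP x.
apply/countable_injP; exists (f \o val) => y z /set_mem yx /set_mem zx fyz.
by apply: val_inj; apply: finj fyz; apply/mem_set.
Qed.

Fact omega1_uncountable : ~ countable [set: omega1].
Proof.
set A := [set w : wo_carrier | countable `]-oo, w[].
move=> /countable_injP[f finj].
have cA : countable A.
  have tot w : A w -> exists x : omega1, val x = w.
    by move=> /mem_set Aw; exists (Sub w Aw).
  pose g w := if pselect (A w) is left Aw then f (sval (cid (tot w Aw))) else 0%N.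
  apply/countable_injP; exists g => v w /set_mem Av /set_mem Aw; rewrite /g.
  case: pselect => // Av'; case: pselect => // Aw'.
  case: cid => x /= <-; case: cid => y /= <- fxy.
  by rewrite (finj x y)// inE.
have AT : A = setT.
  apply/seteqP; split=> // w0 _; apply: contrapT => nAw0.
  pose B : {pred wo_carrier} := fun w => `[< ~ A w >].
  have [w [[/asboolP nAw lew] _]] : exists! w, minimum_of wo_le B w.
    by apply: wo_leP; exists w0; apply/asboolP.
  apply: nAw; rewrite /A /=; apply: sub_countable cA; apply: subset_card_le.
  move=> v /=; rewrite in_itv /= => vw; apply: contrapT => nAv.
  have : w <= v by apply: lew; apply/asboolP.
  by rewrite leNgt vw.
move: cA; rewrite AT => /countable_injP[h hinj].
pose D n := `[< forall u : wo_carrier, h u = n -> ~~ u n >].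
have [Dh|/negP nDh] := boolP (D (h D)).
  by have := Dh; move=> /asboolP/(_ D erefl)/negP.
apply: nDh; apply/asboolP => u hu.
have -> : u = D by apply: hinj; rewrite ?inE.
apply/negP => Dh.
by have := Dh; move=> /asboolP/(_ D erefl)/negP.
Qed.

(* The long ray, omega1 many consecutive copies of `[0, 1[ *)
Definition long_ray (R : realType) := (omega1 *l `[0%R : R, 1%R[%classic)%type.

Definition long_ray1 (R : realType) := osum (long_ray R) 'I_1.

(* The existence of p excludes the one-point and two-point orders, for which
   the last clause would be vacuous. *)
Definition is_long_interval (R : realType) d (L : orderType d) : Prop :=
  exists a b : L,
    [/\ forall x, a <= x <= b,
        exists p, a < p < b
      & forall p, a < p < b ->
          order_iso `[p, b]%classic (long_ray1 R) /\
          order_iso `[a, p]%classic (long_ray1 R)^d].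

Definition embedding (X Y : topologicalType) (f : X -> Y) : Prop :=
  injective f /\ @open X = @open (initial_topology f).

Definition homeomorphic (X Y : topologicalType) : Prop :=
  exists f : X -> Y, embedding f /\ range f = [set: Y].

Definition metrizable (R : realType) (X : topologicalType) : Prop :=
  exists M : metricType R, homeomorphic X M.

Definition retraction (X Y : topologicalType) (f : X -> Y) : Prop :=
  continuous f /\ exists2 g : Y -> X, continuous g & cancel g f.

(* Inverse systems over a linear order; an inverse sequence is an inverse
   system whose index set I is well ordered. *)
Record invsys d (I : orderType d) : Type := Invsys {
  stage :> I -> topologicalType;
  bond : forall i j, i <= j -> stage j -> stage i;
  bond_continuous : forall i j (ij : i <= j), continuous (bond ij);
  bond_id : forall i (ii : i <= i) x, bond ii x = x;
  bond_comp : forall i j k (ij : i <= j) (jk : j <= k) (ik : i <= k) x,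
    bond ij (bond jk x) = bond ik x }.

Definition invsys_restrict d (I : orderType d) (S : invsys I) (D : set I) : invsys D :=
  @Invsys d D (fun i => S (val i)) (fun i j (ij : val i <= val j) => bond ij)
    (fun i j ij => @bond_continuous d I S _ _ ij)
    (fun i ii => @bond_id d I S _ ii)
    (fun i j k ij jk ik => @bond_comp d I S _ _ _ ij jk ik).

Definition threads d (I : orderType d) (S : invsys I) : set (prod_topology (fun i => S i)) :=
  [set x | forall i j (ij : i <= j), bond ij (x j) = x i].
Arguments threads {d I} S _.

Definition is_limit d (I : orderType d) (S : invsys I) (X : topologicalType)
    (q : forall i, X -> S i) : Prop :=
  let qX : X -> prod_topology (fun i => S i) := fun x i => q i x in
  embedding qX /\ range qX = threads S.

(* Limit ordinals are nonzero here. *)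
Definition limit_index d (I : orderType d) (i : I) : Prop :=
  (exists j, j < i) /\ forall j, j < i -> exists k, j < k < i.

Definition bond_below d (I : orderType d) (S : invsys I) (i : I)
    (j : `]-oo, i[%classic) : S i -> invsys_restrict S `]-oo, i[ j :=
  bond (ltW (set_mem (valP j))).

Definition continuous_invsys d (I : orderType d) (S : invsys I) : Prop :=
  forall i, limit_index i -> is_limit (bond_below (S := S) (i := i)).

(* Homeomorphic copies are included: is_limit does not depend on a choice of
   model for the limit, and a one-stage sequence has a limit homeomorphic to
   its stage. *)
Inductive class_R (R : realType) : topologicalType -> Prop :=
| class_R_metrizable (X : topologicalType) :
    compact [set: X] -> metrizable R X -> class_R R X
| class_R_limit d (I : orderType d) (S : invsys I) (X : topologicalType)
    (q : forall i, X -> S i) :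
    well_order (<=%O : rel I) ->
    continuous_invsys S ->
    (forall i j (ij : i <= j), retraction (@bond d I S i j ij)) ->
    (forall i, class_R R (S i)) ->
    is_limit q ->
    class_R R X.

Section Valdivia.
Variable R : realType.

Definition Sigma_product (A : Type) : set {ptws A -> `[0%R : R, 1%R]%classic} :=
  [set x | countable [set a | val (x a) != 0%R]].

Definition valdivia (X : topologicalType) : Prop :=
  compact [set: X] /\
  exists (A : Type) (f : X -> {ptws A -> `[0%R : R, 1%R]%classic}),
    embedding f /\ closure (range f `&` @Sigma_product A) = range f.

End Valdivia.

(* Main.v *)
Require Import Defs.
From HB Require Import structures.
From mathcomp Require Import all_boot all_order all_algebra.
From mathcomp Require Import all_classical wochoice all_reals topology metric_structure function_spaces.
From mathcomp Require Import lra.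

(* Write K as the limit of a continuous inverse sequence of retractions. A
   transfinite induction, choosing sections only at successor steps, yields
   coherent sections, so K contains copies of the stages as an increasing
   chain of intervals with dense union. Two interior points of K are therefore
   interior to some stage already, and induction on the class R shows that the
   interval between two interior points is separable (in the base case because
   metrizable compacta are). A separable complete dense interval is a copy of
   [0, 1]. The only remaining freedom is at each end of K: if the maximum is
   not the supremum of countably many smaller points, then an increasing
   continuous omega1-sequence must converge to it, since otherwise it would
   live in a separable interval, and the right end of K is a long ray; dually
   for the minimum. The coordinates of the pieces of K to the right and to the
   left of an interior point then give a Valdivia embedding. *)

Set Implicit Arguments.
Unset Strict Implicit.
Unset Printing Implicit Defensive.

Import Order.TTheory GRing.Theory Num.Theory.
Import numFieldTopology.Exports.

Local Open Scope classical_set_scope.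
Local Open Scope order_scope.

(** * Parametrization of separable intervals *)

(** The empty set and the whole order are allowed as [A], so completeness also yields a least and a
    greatest element. *)
Definition order_complete d (L : orderType d) :=
  forall A : set L, exists s, forall y, s <= y <-> ubound A y.

Definition order_dense d (L : orderType d) :=
  forall x y : L, x < y -> exists z, x < z < y.

(** Asking for a point of [C] strictly inside every gap makes the interval order dense as well. For
    [q <= p] the condition is vacuous. *)
Definition separable_between d (L : orderType d) (p q : L) :=
  exists2 C : set L, countable C &
    forall x y, p <= x -> x < y -> y <= q -> exists2 c, C c & x < c < y.

Section Dyadic.
Context d (L : orderType d) (p q : L) (e : nat -> L).
Hypothesis pq : p < q.
Hypothesis eP : forall x y, p <= x -> x < y -> y <= q -> exists n, x < e n < y.

(* Splitting every gap at the first e n inside it makes e j a dyadic point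
   of level at most j + 1. *)
Let mid x y := if pselect (exists n, x < e n < y) is left h
  then e (ex_minn h) else x.

Let mid_min x y : p <= x -> x < y -> y <= q -> exists n,
  [/\ mid x y = e n, x < e n < y & forall m, x < e m < y -> (n <= m)%N].
Proof.
move=> px xy yq; rewrite /mid; case: pselect => [h|]; last first.
  by case; exact: eP.
by case: ex_minnP => n nP nmin; exists n.
Qed.

Let mid_itv x y : p <= x -> x < y -> y <= q -> x < mid x y < y.
Proof. by move=> px xy yq; have [n [->]] := mid_min px xy yq. Qed.

(** Level [n] is meant for the indices from [0] to [2 ^ n]: even indices repeat the previous level,
    odd ones split its gaps. *)
Fixpoint dyadic (n k : nat) : L :=
  if n is m.+1 then
    if odd k then mid (dyadic m k./2) (dyadic m k./2.+1) else dyadic m k./2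
  else if k is 0%N then p else q.

Let dyadic_step n k : (k < 2 ^ n)%N ->
  [/\ p <= dyadic n k, dyadic n k < dyadic n k.+1 & dyadic n k.+1 <= q].
Proof.
elim: n k => [|n IH] k; first by rewrite expn0 ltnS leqn0 => /eqP -> /=.
rewrite expnS => kn; have /IH[pj jj1 j1q] : (k./2 < 2 ^ n)%N by rewrite ltn_half_double -mul2n.
have /andP[xm my] := mid_itv pj jj1 j1q.
rewrite /= uphalf_half; case: (boolP (odd k)) => ok /=.
- by rewrite add1n; split => //; exact: le_trans (ltW xm).
- by rewrite add0n; split => //; exact: le_trans (ltW my) _.
Qed.

Lemma dyadic_lt n k l : (k < l <= 2 ^ n)%N -> dyadic n k < dyadic n l.
Proof.
elim: l => [|l IH]; first by rewrite ltn0.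
rewrite ltnS leq_eqVlt => /andP[/predU1P[->|kl] ln].
  by have [] := dyadic_step ln.
have [_ + _] := dyadic_step ln; apply: lt_trans; apply: IH.
by rewrite kl ltnW.
Qed.

Lemma dyadic_le n k l : (k <= l <= 2 ^ n)%N -> dyadic n k <= dyadic n l.
Proof.
by rewrite leq_eqVlt => /andP[/predU1P[->//|kl] ln]; rewrite ltW// dyadic_lt ?kl.
Qed.

Lemma dyadic0 n : dyadic n 0 = p.
Proof. by elim: n. Qed.

Lemma dyadic1 n : dyadic n (2 ^ n) = q.
Proof.
elim: n => [//|n IH] /=; rewrite expnS oddM /=.
by rewrite mul2n doubleK.
Qed.

(** Points of different levels are compared by lifting both to a common level. *)
Lemma dyadicD n m k : dyadic (m + n) (2 ^ m * k) = dyadic n k.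
Proof.
elim: m => [|m IH]; first by rewrite mul1n.
rewrite addSn /= expnS -mulnA oddM /= -IH.
by rewrite mul2n doubleK.
Qed.

Lemma dyadic_ltE n k m l : (k <= 2 ^ n)%N -> (l <= 2 ^ m)%N ->
  (dyadic n k < dyadic m l) = (2 ^ m * k < 2 ^ n * l)%N.
Proof.
move=> kn lm; rewrite -(dyadicD n m k) -(dyadicD m n l) addnC.
apply/idP/idP => [|kl]; last first.
  by apply: dyadic_lt; rewrite kl expnD /= leq_mul2l lm orbT.
apply: contraTT; rewrite -leqNgt -leNgt => kl.
by apply: dyadic_le; rewrite kl expnD mulnC leq_mul2r kn orbT.
Qed.

(** If [e j] is not yet a point of level [n], it lies in a gap of that level, which is split at the
    first [e i] inside it, so [i <= j]. For [i < j] the induction hypothesis would make [e i] a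
    point of level [n] strictly between two neighbours; hence [i = j]. *)
Lemma dyadic_onto n j : (j < n)%N -> p <= e j <= q ->
  exists2 k, (k <= 2 ^ n)%N & dyadic n k = e j.
Proof.
elim: n j => [//|n IH] j jn /andP[pe eq].
have [[k kn kE]|nk] := pselect (exists2 k, (k <= 2 ^ n)%N & dyadic n k = e j).
  exists (2 ^ 1 * k)%N; first by rewrite expn1 expnS leq_mul2l.
  by rewrite -add1n dyadicD.
(* The largest such [k] is the left end of the gap around [e j]. *)
pose P k := (k <= 2 ^ n)%N && (dyadic n k <= e j).
have P0 : exists k, P k by exists 0%N; rewrite /P dyadic0 pe.
have Pb k : P k -> (k <= 2 ^ n)%N by case/andP.
case: (ex_maxnP P0 Pb) => k /andP[kn ke] kmax.
have {}ke : dyadic n k < e j.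
  by rewrite lt_neqAle ke andbT; apply/eqP => E; apply: nk; exists k.
have {}kn : (k < 2 ^ n)%N.
  rewrite ltn_neqAle kn andbT; apply/eqP => E; move: ke.
  by rewrite E dyadic1 ltNge eq.
have ek1 : e j < dyadic n k.+1.
  by rewrite ltNge; apply/negP => h; have := kmax k.+1; rewrite /P kn h ltnn => /(_ isT).
have [pk kk kq] := dyadic_step kn.
have [i [midE /andP[ki ik1] imin]] := mid_min pk kk kq.
have ij : (i <= j)%N by apply: imin; rewrite ke ek1.
have [ijlt|ji] := ltnP i j; last first.
  have ijE : i = j by apply/eqP; rewrite eqn_leq ij ji.
  exists (k.*2.+1)%N; first by rewrite expnS mul2n ltn_double.
  by rewrite /= odd_double /= uphalf_double midE ijE.
have [||l ln lE] := IH i.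
- exact: leq_trans ijlt jn.
- by rewrite (le_trans pk (ltW ki)) (le_trans (ltW ik1) kq).
move: ki ik1; rewrite -lE !dyadic_ltE ?(ltnW kn) //.
by rewrite !ltn_pmul2l ?expn_gt0 // => kl; rewrite ltnS leqNgt kl.
Qed.

End Dyadic.

Section Parametrization.
Context (R : realType) d (L : orderType d).

Let dy (n k : nat) : R := (k%:R / (2 ^ n)%:R)%R.

Let dy_ltE n k m l : ((dy n k < dy m l)%R) = (2 ^ m * k < 2 ^ n * l)%N.
Proof.
have h i : (0 < (2 ^ i)%:R :> R)%R by rewrite ltr0n expn_gt0.
by rewrite /dy ltr_pdivrMr // mulrAC ltr_pdivlMr // -!natrM ltr_nat mulnC (mulnC l).
Qed.

Let dy01 n k : (k <= 2 ^ n)%N -> (0 <= dy n k <= 1)%R.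
Proof.
move=> kn; have h : (0 < (2 ^ n)%:R :> R)%R by rewrite ltr0n expn_gt0.
by rewrite /dy divr_ge0 // ?ler0n // ler_pdivrMr // mul1r ler_nat.
Qed.

Let dy_dense (s t : R) : (0 <= s)%R -> (s < t)%R -> (t <= 1)%R ->
  exists n k, [/\ (k.+1 <= 2 ^ n)%N, (s < dy n k)%R & (dy n k.+1 <= t)%R].
Proof.
(* This [n] gives [2 ^ n > 2 / (t - s)], so two grid steps fit between [s] and [t]; the first grid
   point beyond [s] then has its successor at most [t]. Two points are needed later to make [h]
   strictly increasing. *)
move=> s0 st t1; pose n := Num.truncn (2 / (t - s))%R.
have ts0 : (0 < t - s)%R by rewrite subr_gt0.
have n2 : (2 < (t - s) * (2 ^ n)%:R)%R.
  rewrite mulrC -ltr_pdivrMr //; apply: lt_le_trans (truncnS_gt _) _.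
  by rewrite ler_nat ltn_expl.
have h : (0 < (2 ^ n)%:R :> R)%R by rewrite ltr0n expn_gt0.
have sn0 : (0 <= s * (2 ^ n)%:R)%R by rewrite mulr_ge0 ?ler0n.
exists n, (Num.truncn (s * (2 ^ n)%:R)).+1.
have := truncn_itv sn0; set k := Num.truncn _ => /andP[ks sk].
have kt : (k.+2%:R <= t * (2 ^ n)%:R)%R.
  by rewrite -addn2 natrD; move: n2; rewrite mulrBl; lra.
split; last by rewrite /dy ler_pdivrMr.
- rewrite -(ler_nat R); apply: le_trans kt _.
  by rewrite -[leRHS]mul1r ler_wpM2r // ltW.
- by rewrite /dy ltr_pdivlMr.
Qed.

(* The path sends t to the supremum of the dyadic points of [p, q] with
   parameter at most t. *)
Lemma order_path (p q : L) : order_complete L -> p < q ->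
  separable_between p q ->
  exists h : R -> L,
    [/\ h 0%R = p, h 1%R = q,
        (forall s t, (0 <= s)%R -> (s < t)%R -> (t <= 1)%R -> h s < h t)
      & forall x, p <= x <= q -> exists2 t, (0 <= t <= 1)%R & h t = x].
Proof.
move=> Lc pq [C Cc Cd].
have [c0 Cc0 _] := Cd _ _ (lexx _) pq (lexx _).
have [e eC] : exists e : nat -> L, C `<=` range e.
  have /countable_injP[f finj] := Cc.
  exists (fun n => xget c0 [set x | C x /\ f x = n]) => x Cx; exists (f x) => //.
  case: xgetP => [y -> [Cy fyx]|/(_ x)]; last by case.
  by apply: finj; rewrite ?inE.
have eP x y : p <= x -> x < y -> y <= q -> exists n, x < e n < y.
  by move=> px xy yq; have [c /eC[n _ <-] ?] := Cd x y px xy yq; exists n.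
pose D := dyadic p q e.
have DdyE n k m l : (k <= 2 ^ n)%N -> (l <= 2 ^ m)%N ->
    (D n k < D m l) = (dy n k < dy m l)%R.
  by move=> kn lm; rewrite (dyadic_ltE pq eP) // dy_ltE.
have Ddense x y : p <= x -> x < y -> y <= q ->
    exists n k, (k <= 2 ^ n)%N /\ x < D n k < y.
  move=> px xy yq; have [j /andP[xj jy]] := eP _ _ px xy yq.
  have [||k kn kE] := @dyadic_onto _ L p q e pq eP j.+1 j => //.
    by rewrite (le_trans px (ltW xj)) (le_trans (ltW jy) yq).
  by exists j.+1, k; rewrite /D kE xj jy.
have Dpq n k : (k <= 2 ^ n)%N -> p <= D n k <= q.
  move=> kn; apply/andP; split.
  - by rewrite -(dyadic0 p q e n) (dyadic_le pq eP) ?kn.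
  - by rewrite -[leRHS](dyadic1 p q e n) (dyadic_le pq eP) ?kn ?leqnn.
pose B t : set L := [set x | exists n k, [/\ (k <= 2 ^ n)%N, (dy n k <= t)%R & x = D n k]].
pose h t := sval (cid (Lc (B t))).
have hP t y : h t <= y <-> ubound (B t) y by exact: svalP (cid (Lc (B t))) y.
have hub n k t : (k <= 2 ^ n)%N -> (dy n k <= t)%R -> D n k <= h t.
  by move=> kn kt; apply: (hP t (h t)).1 => //; exists n, k.
have dy00 : dy 0 0 = 0%R by rewrite /dy mul0r.
have dy11 : dy 0 1 = 1%R by rewrite /dy expn0 divr1.
have hpq t : (0 <= t <= 1)%R -> p <= h t <= q.
  move=> /andP[t0 t1]; apply/andP; split.
    by apply: (hub 0%N 0%N) => //; rewrite dy00.
  by apply/hP => _ [n [k [kn _ ->]]]; have /andP[] := Dpq n k kn.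
have hmono s t : (0 <= s)%R -> (s < t)%R -> (t <= 1)%R -> h s < h t.
  move=> s0 st t1; have [n [k [kn sk kt]]] := dy_dense s0 st t1.
  apply: (@le_lt_trans _ _ (D n k)); last first.
    apply: lt_le_trans (hub n k.+1 t kn kt).
    by rewrite DdyE ?(ltnW kn)// dy_ltE ltn_pmul2l ?expn_gt0.
  apply/hP => _ [m [l [lm ls ->]]]; rewrite ltW// DdyE ?(ltnW kn)//.
  exact: le_lt_trans sk.
have honto x : p <= x <= q -> exists2 t, (0 <= t <= 1)%R & h t = x.
  move=> /andP[px xq].
  (* The parameter of [x] is the supremum of the parameters of the dyadic points up to [x]. *)
  pose S : set R := [set r | exists n k, [/\ (k <= 2 ^ n)%N, D n k <= x & r = dy n k]].
  have S0 : S 0%R by exists 0%N, 0%N; rewrite dy00.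
  have Sub : ubound S 1%R by move=> _ [n [k [kn _ ->]]]; have /andP[] := dy01 kn.
  have Ssup : has_sup S by split; [exists 0%R | exists 1%R].
  have t01 : (0 <= sup S <= 1)%R.
    by rewrite (ub_le_sup _ S0) /=; [exact: ge_sup (proj1 Ssup) Sub|exists 1%R].
  exists (sup S) => //.
  have /andP[pt tq] := hpq _ t01.
  apply/le_anti/andP; split; rewrite leNgt; apply/negP => lt.
    (* A dyadic point [D n k] between [x] and [h (sup S)] is exceeded by some dyadic point with
       parameter at most [sup S]. So [dy n k < sup S], and an element of [S] beyond [dy n k] puts
       [D n k] below [x]. *)
    have [n [k [kn /andP[xk kt]]]] := Ddense _ _ px lt tq.
    have /hP/existsNP[_ /not_implyP[[m [l [lm lt' ->]]] /negP]] : ~ h (sup S) <= D n k.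
      by apply/negP; rewrite -ltNge.
    rewrite -ltNge DdyE // => kl.
    have kS : (0 < sup S - dy n k)%R by rewrite subr_gt0 (lt_le_trans kl lt').
    have [_ [i [r [ri rx ->]]]] := sup_adherent kS Ssup.
    rewrite subKr -DdyE // => /lt_le_trans/(_ rx).
    by rewrite ltNge (ltW xk).
  have [n [k [kn /andP[tk kx]]]] := Ddense _ _ pt lt xq.
  have : D n k <= h (sup S).
    apply: hub => //; apply: ub_le_sup; first by exists 1%R.
    by exists n, k; rewrite (ltW kx).
  by rewrite leNgt tk.
(* As [h] is increasing with values between [p] and [q], preimages of these two points pin down
   [h 0] and [h 1]. *)
have [a a01 ha] := honto p ltac:(by rewrite lexx ltW).
have [b b01 hb] := honto q ltac:(by rewrite lexx ltW).
exists h; split=> //; apply/le_anti.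
- have /andP[-> _] := hpq 0%R ltac:(by rewrite lexx ler01); rewrite andbT.
  case/andP: a01 => a0 a1; have [E|ne] := eqVneq a 0%R; first by rewrite -ha E.
  by rewrite -ha ltW// hmono// lt_neqAle eq_sym ne.
- have /andP[_ ->] := hpq 1%R ltac:(by rewrite lexx ler01).
  case/andP: b01 => b0 b1; have [E|ne] := eqVneq b 1%R; first by rewrite -hb E lexx.
  by rewrite -hb ltW// hmono// lt_neqAle ne.
Qed.

End Parametrization.

(** * Order isomorphisms and the long ray *)

Lemma le_set_type d (T : orderType d) (A : set T) (x y : A) :
  (x <= y) = (val x <= val y).
Proof. by []. Qed.

Lemma lt_set_type d (T : orderType d) (A : set T) (x y : A) :
  (x < y) = (val x < val y).
Proof. by rewrite !ltNge. Qed.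

Lemma lt_osum d (T : orderType d) d' (T' : orderType d') (u v : osum T T') :
  (u < v) = match u, v with
    | inl x, inl y => x < y
    | inl _, inr _ => true
    | inr _, inl _ => false
    | inr x, inr y => x < y
    end.
Proof. by rewrite ltNge; case: u v => [x|x] [y|y] //; rewrite ltNge. Qed.

Section OrderIso.
Context d (T : orderType d) d' (T' : orderType d').

Lemma order_iso_lt (f : T -> T') : {homo f : x y / x < y} ->
  (forall y, exists x, f x = y) -> order_iso T T'.
Proof.
move=> fh fs; have fm : {mono f : x y / x <= y} by exact: le_mono.
exists f; split=> //; exists (fun y => sval (cid (fs y))) => [x|y].
- by apply: (inc_inj fm); case: cid.
- by case: cid.
Qed.

Lemma order_iso_sym : order_iso T T' -> order_iso T' T.
Proof.
move=> [f [[g gf fg] fm]]; exists g; split; first by exists f.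
by move=> x y; rewrite -fm !fg.
Qed.

Lemma order_iso_dual : order_iso T^d T' -> order_iso T T'^d.
Proof.
move=> [f [[g gf fg] fm]]; exists f; split; first by exists g.
by move=> x y; rewrite leEdual fm leEdual.
Qed.

End OrderIso.

(** This property decides the shape of a right end; a left end is tested in the dual order. *)
Definition countably_cofinal d (L : orderType d) (b : L) :=
  exists C : set L, [/\ countable C, (forall c, C c -> c < b) &
    forall x, x < b -> exists2 c, C c & x < c].

(** The countable sets for the intervals up to the points [q] of [C] are united. Since [y] may be
    [b] itself, the gap is first shrunk to end at some [z < b], which lies below one of these
    [q]. *)
Lemma separable_of_cofinal d (L : orderType d) (a b : L) : order_dense L ->
  (forall q, q < b -> separable_between a q) -> countably_cofinal b ->
  separable_between a b.
Proof.
move=> Ld Ls [C [Cc Cb Ccof]].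
have /choice[D DP] q : exists D : set L, q < b -> countable D /\
    forall x y, a <= x -> x < y -> y <= q -> exists2 c, D c & x < c < y.
  have [qb|nqb] := pselect (q < b); last by exists set0.
  by have [D Dc Dd] := Ls q qb; exists D.
exists (\bigcup_(q in C) D q).
  by apply: bigcup_countable => // q /Cb/DP[].
move=> x y ax xy yb.
have [z /andP[xz zy]] := Ld _ _ xy.
have [q Cq zq] := Ccof _ (lt_le_trans zy yb).
have [c Dc /andP[xc cz]] := (DP q (Cb _ Cq)).2 x z ax xz (ltW zq).
by exists c; [exists q | rewrite xc (lt_trans cz)].
Qed.

Lemma well_order_ind d (I : orderType d) (P : I -> Prop) :
  well_order (<=%O : rel I) ->
  (forall i, (forall j, j < i -> P j) -> P i) -> forall i, P i.
Proof.
move=> wo IH i; apply: contrapT => nPi.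
have [|m [[/asboolP nPm mmin] _]] := wo (fun i => `[< ~ P i >]).
  by exists i; apply/asboolP.
apply: nPm; apply: IH => j jm; apply: contrapT => nPj.
have : m <= j by apply: mmin; apply/asboolP.
by rewrite leNgt jm.
Qed.

Lemma omega1_wf : well_founded (fun x y : omega1 => x < y).
Proof. by apply: (well_order_ind omega1_well_order) => i IH; constructor. Qed.

(** * Right ends of complete intervals: unit interval or long ray *)

Section RightStructure.
Context (R : realType) d (L : orderType d) (a b : L).
Hypotheses (Lc : order_complete L) (Ld : order_dense L).
Hypotheses (ab : a < b) (Lab : forall x, a <= x <= b).
Hypothesis Ls : forall q, q < b -> separable_between a q.

Let ax x : a <= x. Proof. by have /andP[] := Lab x. Qed.
Let xb x : x <= b. Proof. by have /andP[] := Lab x. Qed.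

Lemma order_iso_unit_interval :
  countably_cofinal b -> order_iso L `[0%R : R, 1%R]%classic.
Proof.
move=> /(separable_of_cofinal Ld Ls) Lsep.
have [h [h0 h1 hm ho]] := order_path R Lc ab Lsep.
apply: order_iso_sym; apply: (order_iso_lt (f := fun t : `[0%R : R, 1%R]%classic => h (val t))).
- move=> s t; rewrite lt_set_type => st; apply: hm => //.
  + by have := set_mem (valP s); rewrite /= in_itv => /andP[].
  + by have := set_mem (valP t); rewrite /= in_itv => /andP[].
- move=> y; have [t t01 <-] := ho y (Lab y).
  have tI : t \in `[0%R : R, 1%R]%classic by rewrite inE /= in_itv.
  by exists (Sub t tI).
Qed.

Hypothesis nb : ~ countably_cofinal b.

Let sup A := sval (cid (Lc A)).
Let supP A y : sup A <= y <-> ubound A y. Proof. exact: svalP (cid (Lc A)) y. Qed.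

(** A chosen step towards [b]; the value [x] elsewhere is a default that makes [s] total. *)
Let s x := if pselect (x < b) is left xb then sval (cid (Ld xb)) else x.
Let sP x : x < b -> x < s x < b.
Proof. by rewrite /s => x_b; case: pselect => // h; case: cid. Qed.

(* The supremum covers the zero, successor and limit stages at once. *)
Let c : omega1 -> L := Fix omega1_wf (fun _ => L)
  (fun i rec => sup [set y | exists j (ji : j < i), y = s (rec j ji)]).

Let cE i : c i = sup [set s (c j) | j in `]-oo, i[].
Proof.
rewrite /c Fix_eq => [|x f g fg].
  congr sup; apply/seteqP; split=> y /=.
  - by move=> [j [ji ->]]; exists j => //; rewrite in_itv.
  - by move=> [j + <-]; rewrite in_itv => ji; exists j, ji.
by congr sup; apply/seteqP; split=> y [j [ji ->]]; exists j, ji; rewrite fg.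
Qed.

(** Initial segments of [omega1] are countable, so reaching [b] at stage [i] would make the points
    [s (c j)] with [j < i] a countable cofinal set. *)
Let c_lt i : c i < b.
Proof.
move: i; apply: (well_order_ind omega1_well_order) => i IH.
rewrite lt_neqAle xb andbT; apply/eqP => cib; apply: nb.
exists [set s (c j) | j in `]-oo, i[]; split.
- exact: sub_countable (card_image_le _ _) (omega1_countable_below _).
- by move=> _ [j + <-]; rewrite /= in_itv => /IH/sP/andP[].
- move=> x; rewrite -cib cE => /lt_geF/negP xlt.
  have /existsNP[y /not_implyP[Ay /negP]] := fun h => xlt ((supP _ _).2 h).
  by rewrite -ltNge => xy; exists y.
Qed.

Let s_le i j : i < j -> s (c i) <= c j.
Proof.
move=> ij; rewrite (cE j); apply: (supP _ _).1 (lexx _) _ _.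
by exists i => //=; rewrite in_itv.
Qed.

(** If the sequence stayed below [x], the uncountably many disjoint intervals from [c i] to
    [s (c i)] would lie in a separable interval, and picking a point of the countable set in each
    would inject [omega1] into it. *)
Let c_cof x : x < b -> exists i, x < s (c i).
Proof.
move=> xltb; apply: contrapT => /forallNP h.
have {}h i : s (c i) <= x by rewrite leNgt; apply/negP.
have [D Dc Dd] := Ls xltb.
have /choice[f fP] i : exists y, D y /\ c i < y < s (c i).
  have /andP[cs _] := sP (c_lt i).
  by have [y Dy yi] := Dd _ _ (ax _) cs (h i); exists y.
apply: omega1_uncountable; have /countable_injP[g ginj] := Dc.
apply/countable_injP; exists (g \o f) => i j _ _ /= /ginj.
rewrite !inE => /(_ (fP i).1 (fP j).1) fij.
have [_ /andP[ci si]] := fP i; have [_ /andP[cj sj]] := fP j.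
have [ij|ji|//] := ltgtP i j.
- have := lt_le_trans si (s_le ij).
  by rewrite fij => /(lt_trans cj); rewrite ltxx.
- have := lt_le_trans sj (s_le ji).
  by rewrite -fij => /(lt_trans ci); rewrite ltxx.
Qed.

Let path i : {h : R -> L |
    [/\ h 0%R = c i, h 1%R = s (c i),
        (forall s t, (0 <= s)%R -> (s < t)%R -> (t <= 1)%R -> h s < h t)
      & forall x, c i <= x <= s (c i) -> exists2 t, (0 <= t <= 1)%R & h t = x]}.
Proof.
apply: cid; have /andP[cs sb] := sP (c_lt i).
apply: order_path => //; have [D Dc Dd] := Ls sb.
by exists D => // x y _; apply: Dd.
Qed.

(** The half-open intervals from [c i] to [s (c i)] tile everything below [b], and [path i] makes
    each a copy of [[0, 1[]. The added last point goes to [b]. *)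
Lemma order_iso_long_ray1 : order_iso L (long_ray1 R).
Proof.
apply: order_iso_sym.
pose f (x : long_ray1 R) : L :=
  if x is inl it then sval (path it.1) (val it.2) else b.
have fitv i (t : `[0%R : R, 1%R[%classic) :
    c i <= sval (path i) (val t) < s (c i).
  case: (path i) => h /= [h0 h1 hm _].
  have /= := set_mem (valP t); rewrite in_itv => /andP[t0 t1].
  rewrite -h1 hm // andbT -h0.
  have [->//|tn0] := eqVneq (val t) 0%R.
  by rewrite ltW// hm// ?(ltW t1)// lt_neqAle eq_sym tn0.
apply: (order_iso_lt (f := f)) => [u v|y].
  rewrite lt_osum; case: u v => [[i t]|u] [[j t']|v] //=; last first.
  - by rewrite (ord1 u) (ord1 v) ltxx.
  - move=> _; have /andP[_ h1] := fitv i t.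
    exact: lt_le_trans h1 (xb _).
  rewrite ltEprodlexi /=.
  case/andP; rewrite le_eqVlt => /predU1P[<-{j}|ij].
    rewrite lexx /= lt_set_type => tt'.
    case: (path i) => h /= [_ _ hm _]; apply: hm => //.
    + by have /= := set_mem (valP t); rewrite in_itv => /andP[].
    + by have /= := set_mem (valP t'); rewrite in_itv => /andP[_ /ltW].
  move=> _; have /andP[_ h1] := fitv i t; have /andP[h2 _] := fitv j t'.
  exact: lt_le_trans h1 (le_trans (s_le ij) h2).
have [->|ynb] := eqVneq y b; first by exists (inr ord0).
have /c_cof : y < b by rewrite lt_neqAle ynb xb.
move=> [i0 yi0].
(* For the least [i] with [y < s (c i)], all earlier [s (c j)] are at most [y], hence so is their
   supremum [c i]. *)
have [|i [[/asboolP yi imin] _]] := omega1_well_order (A := fun i => `[< y < s (c i) >]).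
  by exists i0; apply/asboolP.
have ciy : c i <= y.
  rewrite cE; apply/supP => _ [j + <-]; rewrite /= in_itv /= => ji.
  rewrite leNgt; apply/negP => yj.
  have : i <= j by apply: imin; apply/asboolP.
  by rewrite leNgt ji.
have [t /andP[t0 t1] ht] : exists2 t, (0 <= t <= 1)%R & sval (path i) t = y.
  by case: (path i) => h /= [_ _ _]; apply; rewrite ciy ltW.
have {}t1 : (t < 1)%R.
  rewrite lt_neqAle t1 andbT; apply/eqP => t1E; move: ht; rewrite t1E.
  by case: (path i) => h /= [_ -> _ _] yE; move: yi; rewrite yE ltxx.
have tI : t \in `[0%R : R, 1%R[%classic by rewrite inE /= in_itv /= t0.
by exists (inl (i, Sub t tI)).
Qed.

End RightStructure.

(** * Embeddings, products and compact ordered spaces *)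

Lemma continuous_prod (I : Type) (T : I -> topologicalType) (X : topologicalType)
    (f : X -> prod_topology T) :
  (forall i, continuous (fun x => f x i)) -> continuous f.
Proof.
move=> cf x; apply/cvg_sup => i; move: x.
apply/(@continuousP _ (initial_topology (fun g : prod_topology T => g i))).
move=> _ [B oB <-]; exact: (continuousP (fun x => f x i)).1 (cf i) B oB.
Qed.

Lemma continuous_coord (I : Type) (T : I -> topologicalType) (i : I) :
  continuous (fun f : prod_topology T => f i).
Proof. exact: (@proj_continuous {classic I} T i). Qed.

Section Embedding.
Context (X Y : topologicalType) (f : X -> Y).
Hypothesis fe : embedding f.

Lemma embedding_openP (U : set X) :
  open U <-> exists2 V : set Y, open V & f @^-1` V = U.
Proof. by rewrite fe.2. Qed.

Lemma embedding_continuous : continuous f.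
Proof. by apply/continuousP => V oV; apply/embedding_openP; exists V. Qed.

Lemma continuous_embedding (Z : topologicalType) (g : Z -> X) :
  continuous (f \o g) -> continuous g.
Proof.
move=> /continuousP cfg; apply/continuousP => _ /embedding_openP[V oV <-].
exact: cfg.
Qed.

Lemma embedding_hausdorff : hausdorff_space Y -> hausdorff_space X.
Proof.
move=> hY x y xy; apply: fe.1; apply: hY => A B /embedding_continuous xA.
by move=> /embedding_continuous yB; have [z [Az Bz]] := xy _ _ xA yB; exists (f z).
Qed.

Lemma embedding_compact : compact (range f) -> compact [set: X].
Proof.
move=> cr F PF _; have [|_ [[x _ <-] xcl]] := cr (f @ F) _.
  by rewrite /fmap /=; apply: filterE => x; exists x.
exists x; split=> // A B FA; rewrite nbhsE => -[U [/embedding_openP[V oV VU] Ux UB]].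
have [||_ [[z Az <-] Vz]] := xcl (f @` A) V.
- by rewrite /fmap /=; apply: filterS FA => z; exists z.
- by apply: open_nbhs_nbhs; split=> //; have : (f @^-1` V) x by rewrite VU.
by exists z; split=> //; apply: UB; rewrite -VU.
Qed.

End Embedding.

Lemma closed_eq (X Y : topologicalType) (f g : X -> Y) : hausdorff_space Y ->
  continuous f -> continuous g -> closed [set x | f x = g x].
Proof.
move=> hY cf cg x clx; apply: hY => A B /cf fA /cg gB.
have AB : nbhs x (f @^-1` A `&` g @^-1` B) by exact: filterI.
by have [z [fgz [Az Bz]]] := clx _ AB; exists (f z); split=> //; rewrite fgz.
Qed.

(** The threads form an intersection of equalizers of continuous maps into Hausdorff spaces. The
    intersection is indexed by bare pairs, so the order proof is quantified inside each member. *)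
Lemma threads_closed d (I : orderType d) (S : invsys I) :
  (forall i, hausdorff_space (S i)) -> closed (threads S).
Proof.
move=> hS.
have -> : threads S = \bigcap_(k in [set k : I * I | k.1 <= k.2])
    [set x : prod_topology (fun i => S i) |
      forall h : k.1 <= k.2, @bond d I S _ _ h (x k.2) = x k.1].
  apply/seteqP; split=> [x xS [i j] /= ij h|x xS i j ij]; first exact: xS.
  exact: (xS (i, j) ij).
apply: closed_bigI => -[i j] /= ij.
have -> : [set x : prod_topology (fun i => S i) |
    forall h : i <= j, bond h (x j) = x i] = [set x | bond ij (x j) = x i].
  by apply/seteqP; split=> x /= xE // h; rewrite -xE; congr (bond _ _); exact: bool_irrelevance.
apply: closed_eq => //; last exact: continuous_coord.
move=> x; apply: continuous_comp; first exact: continuous_coord.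
exact: bond_continuous.
Qed.

Lemma compact_prod (I : eqType) (T : I -> topologicalType) :
  (forall i, compact [set: T i]) -> compact [set: prod_topology T].
Proof.
move=> cT; have := tychonoff cT.
by congr compact; apply/seteqP; split.
Qed.

(** A limit is a copy of a closed set of threads in a product of compact Hausdorff spaces. *)
Lemma class_R_compact_hausdorff (R : realType) (X : topologicalType) :
  class_R R X -> compact [set: X] /\ hausdorff_space X.
Proof.
elim=> {X} [X cX [M [f [fe _]]]|d I S X q _ _ _ _ IH [qe qr]].
  by split=> //; apply: embedding_hausdorff fe _; exact: metric_hausdorff.
have hS i := (IH i).2; split.
  apply: (embedding_compact qe); rewrite qr.
  apply: (@subclosed_compact _ _ setT) => //; first exact: threads_closed.
  by apply: compact_prod => i; case: (IH i).
by apply: embedding_hausdorff qe _; exact: hausdorff_product.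
Qed.

Section CompactOrder.
Context d (K : orderTopologicalType d).

(** A cluster point of the tails of [A] is its supremum. For empty [A], a cluster point of the
    initial rays is the least element. *)
Lemma compact_order_complete :
  [set: K] !=set0 -> compact [set: K] -> order_complete K.
Proof.
move=> [k0 _] cK A; have [[a0 Aa0]|A0] := pselect (A !=set0); last first.
  pose F := filter_from [set: K] (fun a => `]-oo, a]%classic).
  have [||m [_ mcl]] := cK F.
  - apply: filter_from_proper; last by move=> a _; exists a; rewrite /= in_itv /=.
    apply: filter_from_filter; first by exists k0.
    move=> a b _ _; exists (Order.min a b) => // x /=.
    by rewrite !in_itv /= le_min => /andP.
  - by exists k0.
  exists m => y; split=> [_ x Ax|_]; first by case: A0; exists x.
  rewrite leNgt; apply/negP => ym.
  have [||z []] := mcl `]-oo, y]%classic `]y, +oo[%classic.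
  - by exists y.
  - by apply: open_nbhs_nbhs; split; [exact: rray_open | rewrite /= in_itv /= ym].
  by rewrite /= !in_itv /= andbT leNgt => /negP.
pose F := filter_from A (fun a => A `&` `[a, +oo[%classic).
have [||s [_ scl]] := cK F.
- apply: filter_from_proper; last by move=> a Aa; exists a; split; rewrite //= in_itv /= lexx.
  apply: filter_from_filter; first by exists a0.
  move=> a b Aa Ab; exists (Order.max a b); first by case: leP.
  move=> x [Ax]; rewrite /= in_itv /= andbT ge_max => /andP[ax bx].
  by split; split; rewrite //= in_itv /= ?ax ?bx.
- by exists a0.
exists s => y; split=> [sy a Aa|yub]; rewrite leNgt; apply/negP => lt.
- have [||z [[_ az] za]] := scl (A `&` `[a, +oo[%classic) `]-oo, a[%classic.
  + by exists a.
  + apply: open_nbhs_nbhs; split; first exact: lray_open.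
    by rewrite /= in_itv /= (le_lt_trans sy).
  by move: az za; rewrite /= !in_itv /= andbT leNgt => /negP.
- have [||z [Az]] := scl A `]y, +oo[%classic.
  + by exists a0 => // x [].
  + by apply: open_nbhs_nbhs; split; [exact: rray_open | rewrite /= in_itv /= lt].
  by rewrite /= in_itv /= andbT ltNge yub.
Qed.

(** Across an empty gap the cuts []-oo, v[] and []-oo, u]] have the same trace on [A], which would
    be a proper clopen part. *)
Lemma connected_between (A : set K) (u v : K) : connected A -> A u -> A v ->
  u < v -> exists2 w, A w & u < w < v.
Proof.
move=> cA Au Av uv; apply: contrapT => h.
have : A `&` `]-oo, v[%classic = A.
  apply: cA; first by exists u; split; rewrite //= in_itv /=.
  - by exists `]-oo, v[%classic => //; exact: lray_open.
  exists `]-oo, u]%classic; first exact: lray_closed.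
  apply/seteqP; split=> w [Aw]; rewrite /= in_itv /= => wv; split=> //; rewrite /= in_itv /=.
    by rewrite leNgt; apply/negP => uw; apply: h; exists w => //; rewrite uw.
  exact: le_lt_trans uv.
by move=> E; move: Av; rewrite -E => -[_]; rewrite /= in_itv /= ltxx.
Qed.

Lemma connected_convex (A : set K) (u v w : K) : connected A -> A u -> A v ->
  u < w < v -> A w.
Proof.
move=> cA Au Av /andP[uw wv]; apply: contrapT => nAw.
have : A `&` `]-oo, w[%classic = A.
  apply: cA; first by exists u; split; rewrite //= in_itv /=.
  - by exists `]-oo, w[%classic => //; exact: lray_open.
  exists `]-oo, w]%classic; first exact: lray_closed.
  apply/seteqP; split=> x [Ax]; rewrite /= in_itv /= => xw; split=> //; rewrite /= in_itv /=.
    exact: ltW.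
  by rewrite lt_neqAle xw andbT; apply/eqP => xE; apply: nAw; rewrite -xE.
by move=> E; move: Av; rewrite -E => -[_]; rewrite /= in_itv /= ltNge (ltW wv).
Qed.

End CompactOrder.

(** * Coherent sections of inverse sequences *)

Section CoherentSections.
Context d (I : orderType d) (S : invsys I).
Hypothesis wo : well_order (<=%O : rel I).
Hypothesis Scont : continuous_invsys S.
Hypothesis Sretr : forall i j (ij : i <= j), retraction (@bond d I S i j ij).

Let sec i j (ij : i <= j) : S i -> S j := s2val (cid2 (Sretr ij).2).

Let sec_continuous i j (ij : i <= j) : continuous (sec ij).
Proof. by rewrite /sec; case: cid2. Qed.

Let secK i j (ij : i <= j) : cancel (sec ij) (bond ij).
Proof. by rewrite /sec; case: cid2. Qed.

Let bondE i j (h h' : i <= j) (x : S j) : bond h x = bond h' x.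
Proof. by congr (bond _ _); exact: bool_irrelevance. Qed.

Let le_cases (i j : I) : i <= j -> i = j \/ i < j.
Proof. by rewrite le_eqVlt => /predU1P. Qed.

Let le_or_lt (i j : I) : i <= j \/ j < i.
Proof. by case: leP => _; [left|right]. Qed.

Let adjacent (k l : I) := k < l /\ forall m, ~ k < m < l.

Let adjacent_uniq k k' l : adjacent k l -> adjacent k' l -> k = k'.
Proof.
move=> [kl nkl] [kl' nkl']; have [lt|lt|//] := ltgtP k k'.
  by case: (nkl k'); rewrite lt.
by case: (nkl' k); rewrite lt.
Qed.

Let zero_succ_limit i j : i < j -> (exists k, adjacent k j) \/ limit_index j.
Proof.
move=> ij; have [h|nh] := pselect (exists k, adjacent k j); [by left|right].
split=> [|k kj]; first by exists i.
apply: contrapT => nk; apply: nh; exists k; split=> // m mkj.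
by apply: nk; exists m.
Qed.

(* Only the sections over adjacent indices are chosen freely: above stage i,
   the point y of stage j must follow them. *)
Let coherent i j (y : S j) := forall k l (kl : k <= l) (lj : l <= j) (kj : k <= j),
  i <= k -> adjacent k l -> bond lj y = sec kl (bond kj y).

Let coherent_bond i j k (jk : j <= k) (y : S k) : coherent i y -> coherent i (bond jk y).
Proof.
move=> cy m l ml lj mj im aml.
by rewrite !(bond_comp _ _ (le_trans _ jk)) (cy _ _ ml _ (le_trans mj jk)).
Qed.

Let coherent_uniq i j (ij : i <= j) (y y' : S j) : coherent i y -> coherent i y' ->
  bond ij y = bond ij y' -> y = y'.
Proof.
move: j ij y y'; apply: (well_order_ind wo) => j IH ij y y' cy cy' yy'.
have [E|ltij] := le_cases ij.
  by subst j; move: yy'; rewrite !bond_id.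
have below k (kj : k < j) : bond (ltW kj) y = bond (ltW kj) y'.
  have [ik|ki] := le_or_lt i k.
    apply: (IH k kj ik); try exact: coherent_bond.
    by rewrite !(bond_comp _ _ ij).
  by rewrite -!(bond_comp (ltW ki) ij) yy'.
have [[k akj]|/Scont[[inj _] _]] := zero_succ_limit ltij.
  have kj := akj.1; have ik : i <= k by rewrite leNgt; apply/negP => ki; case: (akj.2 i); rewrite ki.
  rewrite -(bond_id (lexx j) y) -(bond_id (lexx j) y').
  rewrite (cy _ _ (ltW kj) (lexx j) (ltW kj) ik akj).
  by rewrite (cy' _ _ (ltW kj) (lexx j) (ltW kj) ik akj) below.
apply: inj; apply: functional_extensionality_dep => -[k kI] /=.
rewrite /bond_below /=; move: kI (ltW _) => /= kI kj.
have kltj : k < j by have := set_mem kI; rewrite /= in_itv.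
by rewrite !(bondE kj (ltW kltj)).
Qed.

(** Induction on [j]: a successor stage applies the chosen section; at a limit, uniqueness turns the
    earlier lifts into a thread, which continuity of the system realizes by a point. *)
Let coherent_exists i j (ij : i <= j) (x : S i) :
  exists y : S j, bond ij y = x /\ coherent i y.
Proof.
move: j ij; apply: (well_order_ind wo) => j IH ij.
have [E|ltij] := le_cases ij.
  subst j; exists x; split; first exact: bond_id.
  move=> k l kl li ki ik [kl' _]; move: (lt_le_trans kl' li).
  by rewrite ltNge ik.
have [[k akj]|jlim] := zero_succ_limit ltij.
  have kj := akj.1; have ik : i <= k by rewrite leNgt; apply/negP => ki; case: (akj.2 i); rewrite ki.
  have [z [zx cz]] := IH k kj ik.
  exists (sec (ltW kj) z); split.
    by rewrite -(bond_comp ik (ltW kj)) secK.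
  move=> m l ml lj mj im aml.
  have [E|ltlj] := le_cases lj.
    subst l; have E := adjacent_uniq aml akj; subst m.
    by rewrite bond_id (bondE mj (ltW kj)) secK; congr (sec _ _); exact: bool_irrelevance.
  have lk : l <= k by rewrite leNgt; apply/negP => kl; case: (akj.2 l); rewrite kl.
  have mk : m <= k by exact: le_trans ml lk.
  rewrite -(bond_comp lk (ltW kj)) -(bond_comp mk (ltW kj)) secK.
  exact: cz.
have [_ rng] := Scont jlim.
(* A thread below [j] needs a value at every stage: the coherent lift of [x] from [i] on, the
   projection of [x] up to [i]. At [i] both clauses give [x]. *)
pose P (k : I) (z : S k) := (forall ik : i <= k, bond ik z = x /\ coherent i z) /\
  (forall ki : k <= i, z = bond ki x).
have ex (k : `]-oo, j[%classic) : exists z : S (val k), P (val k) z.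
  have kj : val k < j by have := set_mem (valP k); rewrite /= in_itv.
  have [ki|ik] := le_or_lt (val k) i.
    exists (bond ki x); split=> [ik|ki']; last exact: bondE.
    have E : i = val k by apply/le_anti; rewrite ik ki.
    case: k ki ik E kj => k kI /= ki ik E kj; subst k.
    rewrite !bond_id; split=> // m l ml li mi im [ml' _].
    by move: (lt_le_trans ml' li); rewrite ltNge im.
  have [z [zx cz]] := IH _ kj (ltW ik); exists z; split=> [ik'|ki].
    by rewrite (bondE ik' (ltW ik)).
  by move: (ik); rewrite ltNge ki.
pose t : prod_topology (fun k : `]-oo, j[%classic => S (val k)) := fun k => sval (cid (ex k)).
have tP k : P (val k) (t k) by exact: svalP (cid (ex k)).
have : threads (invsys_restrict S `]-oo, j[) t.
  (* From [i] on, the projection of the lift at [l] is again a coherent lift of [x], so uniqueness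
     identifies it with the component at [k]. *)
  move=> k l kl; rewrite /=; have [ik|ki] := le_or_lt i (val k).
    have il : i <= val l by exact: le_trans ik kl.
    have [bk ck] := (tP k).1 ik; have [bl cl] := (tP l).1 il.
    apply: (coherent_uniq (ij := ik)) => //; first exact: coherent_bond.
    by rewrite (bond_comp _ _ il) bl.
  rewrite ((tP k).2 (ltW ki)); have [il|li] := le_or_lt i (val l).
    by have [<- _] := (tP l).1 il; apply: esym; exact: bond_comp.
  by rewrite ((tP l).2 (ltW li)); exact: bond_comp.
rewrite -rng => -[y _ yt].
have ty k (kj : k < j) (kI : k \in `]-oo, j[%classic) :
    bond (ltW kj) y = t (exist _ k kI).
  by rewrite -yt /bond_below /=; exact: bondE.
have mI k : k < j -> k \in `]-oo, j[%classic by rewrite inE /= in_itv.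
exists y; split.
  rewrite (bondE ij (ltW ltij)) (ty _ _ (mI _ ltij)).
  by have [+ _] := (tP (exist _ i (mI _ ltij))).1 (lexx i); rewrite bond_id.
move=> k l kl lj kj ik akl.
(* A limit index is never the upper member of an adjacent pair, so coherence of the component at [l]
   is enough. *)
have ltlj : l < j.
  rewrite lt_neqAle lj andbT; apply/eqP => E; subst l.
  have [m /andP[km mj]] := jlim.2 k akl.1.
  by case: (akl.2 m); rewrite km.
have il : i <= l by exact: le_trans ik kl.
have [_ cl] := (tP (exist _ l (mI _ ltlj))).1 il.
rewrite -(bond_comp kl (ltW ltlj)) (bondE lj (ltW ltlj)) (ty _ _ (mI _ ltlj)).
by have := cl k l kl (lexx l) kl ik akl; rewrite bond_id.
Qed.

(** By uniqueness of coherent lifts these sections compose, which the freely chosen [sec] need not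
    do. *)
Let emb i j (ij : i <= j) (x : S i) : S j := sval (cid (coherent_exists ij x)).

Let embP i j (ij : i <= j) x : bond ij (emb ij x) = x /\ coherent i (emb ij x).
Proof. exact: svalP (cid (coherent_exists ij x)). Qed.

Let emb_uniq i j (ij : i <= j) x y : bond ij y = x -> coherent i y -> y = emb ij x.
Proof.
move=> yx cy; have [ex ce] := embP ij x.
by apply: (coherent_uniq (ij := ij)) => //; rewrite yx ex.
Qed.

Let bond_emb i j k (ij : i <= j) (jk : j <= k) (ik : i <= k) x :
  bond jk (emb ik x) = emb ij x.
Proof.
have [ex ce] := embP ik x; apply: emb_uniq; last exact: coherent_bond.
by rewrite (bond_comp _ _ ik).
Qed.

Let emb_comp i j k (ij : i <= j) (jk : j <= k) (ik : i <= k) x :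
  emb jk (emb ij x) = emb ik x.
Proof.
apply: esym; apply: emb_uniq; first exact: bond_emb.
have [_ ce] := embP ik x => m l ml lk mk jm; apply: ce; exact: le_trans jm.
Qed.

(** At a successor [emb] is a chosen section after an earlier [emb]; at a limit, continuity is
    checked on the coordinates, each an earlier [emb] or a bonding map. *)
Let emb_continuous i j (ij : i <= j) : continuous (emb ij).
Proof.
move: j ij; apply: (well_order_ind wo) => j IH ij.
have [E|ltij] := le_cases ij.
  subst j; rewrite (_ : emb ij = id); first by move=> x.
  apply/funext => x; apply: esym; apply: emb_uniq; first exact: bond_id.
  move=> k l kl li ki ik [kl' _]; move: (lt_le_trans kl' li).
  by rewrite ltNge ik.
have [[k akj]|/Scont[qe _]] := zero_succ_limit ltij.
  have kj := akj.1; have ik : i <= k by rewrite leNgt; apply/negP => ki; case: (akj.2 i); rewrite ki.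
  rewrite (_ : emb ij = sec (ltW kj) \o emb ik).
    by move=> x; apply: continuous_comp; [exact: IH|exact: sec_continuous].
  apply/funext => x /=; have [_ ce] := embP ij x.
  have := ce k j (ltW kj) (lexx j) (ltW kj) ik akj.
  by rewrite bond_id (bond_emb ik).
apply: (continuous_embedding qe); apply: continuous_prod => k.
have kj : val k < j by have := set_mem (valP k); rewrite /= in_itv.
have [ik|ki] := le_or_lt i (val k).
  rewrite (_ : (fun x => _) = emb ik); first exact: IH.
  by apply/funext => x; rewrite /= /bond_below bond_emb.
rewrite (_ : (fun x => _) = bond (ltW ki)); first exact: bond_continuous.
apply/funext => x; rewrite /= /bond_below -(bond_comp (ltW ki) ij).
by have [-> _] := embP ij x.
Qed.

Section Limit.
Context (X : topologicalType) (q : forall i, X -> S i).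
Hypothesis qlim : is_limit q.

Let qX : X -> prod_topology (fun i => S i) := fun x i => q i x.

Let qe : embedding qX. Proof. exact: qlim.1. Qed.

Let q_inj x y : (forall i, q i x = q i y) -> x = y.
Proof.
by move=> h; apply: qlim.1.1; apply: functional_extensionality_dep.
Qed.

Let bond_q i j (ij : i <= j) x : bond ij (q j x) = q i x.
Proof.
have : range (fun x i => q i x) (fun i => q i x) by exists x.
by rewrite qlim.2 => /(_ _ _ ij).
Qed.

Let emb_id i (h : i <= i) x : emb h x = x.
Proof. by have [+ _] := embP h x; rewrite bond_id. Qed.

Let embE i j (h h' : i <= j) x : emb h x = emb h' x.
Proof. by rewrite (bool_irrelevance h h'). Qed.

Let limit_section_exists i (x : S i) : exists y, forall j,
  (forall ij : i <= j, q j y = emb ij x) /\ (forall ji : j <= i, q j y = bond ji x).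
Proof.
have ex j : exists z : S j,
    (forall ij : i <= j, z = emb ij x) /\ (forall ji : j <= i, z = bond ji x).
  have [ij|ji] := le_or_lt i j.
    exists (emb ij x); split=> [ij'|ji]; first exact: embE.
    have E : i = j by exact/le_anti/andP.
    by subst j; rewrite emb_id bond_id.
  exists (bond (ltW ji) x); split=> [ij|ji']; last exact: bondE.
  by have := lt_le_trans ji ij; rewrite ltxx.
pose t : prod_topology (fun j => S j) := fun j => sval (cid (ex j)).
have tP j : (forall ij : i <= j, t j = emb ij x) /\ (forall ji : j <= i, t j = bond ji x).
  exact: svalP (cid (ex j)).
have : threads S t.
  move=> j k jk; have [ij|ji] := le_or_lt i j.
    have ik := le_trans ij jk.
    by rewrite ((tP j).1 ij) ((tP k).1 ik) bond_emb.
  rewrite ((tP j).2 (ltW ji)); have [ik|ki] := le_or_lt i k.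
    rewrite ((tP k).1 ik) -(bond_comp (ltW ji) ik).
    by have [-> _] := embP ik x.
  by rewrite ((tP k).2 (ltW ki)) (bond_comp _ _ (ltW ji)).
rewrite -qlim.2 => -[y _ yt]; exists y => j.
by have := tP j; rewrite -yt.
Qed.

Let lsec i (x : S i) : X := sval (cid (limit_section_exists x)).

Let q_lsec_ge i j (ij : i <= j) (x : S i) : q j (lsec x) = emb ij x.
Proof. exact: (svalP (cid (limit_section_exists x)) j).1. Qed.

Let q_lsec_le i j (ji : j <= i) (x : S i) : q j (lsec x) = bond ji x.
Proof. exact: (svalP (cid (limit_section_exists x)) j).2. Qed.

Let lsec_continuous i : continuous (@lsec i).
Proof.
apply: (continuous_embedding qe).
apply: continuous_prod => j.
have [ij|ji] := le_or_lt i j.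
  rewrite (_ : (fun x => _) = emb ij); first exact: emb_continuous.
  by apply/funext => x; exact: q_lsec_ge.
rewrite (_ : (fun x => _) = bond (ltW ji)); first exact: bond_continuous.
by apply/funext => x; exact: q_lsec_le.
Qed.

(** Ranges increase because the lifts compose. For the last clause, [g i (q i x)] has the same
    coordinate [j] as [x] as soon as [j <= i], so it converges to [x] along the tails of [I]; [i0]
    makes the filter of tails proper. *)
Lemma limit_sections : exists g : forall i, S i -> X,
  [/\ forall i, continuous (g i), forall i, cancel (g i) (q i),
      forall i j, i <= j -> range (g i) `<=` range (g j)
    & forall (i0 : I) (U : set X) x, open U -> U x -> exists i, U (g i (q i x))].
Proof.
exists (@lsec); split.
- exact: lsec_continuous.
- by move=> i x; apply: etrans (q_lsec_ge (lexx i) x) (emb_id _ _).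
- move=> i j ij _ [x _ <-]; exists (emb ij x) => //; apply: q_inj => k.
  have [jk|kj] := le_or_lt j k.
    by rewrite (q_lsec_ge jk) (q_lsec_ge (le_trans ij jk)); exact: emb_comp.
  rewrite (q_lsec_le (ltW kj)); have [ik|ki] := le_or_lt i k.
    by rewrite (q_lsec_ge ik); exact: bond_emb.
  rewrite (q_lsec_le (ltW ki)) -(bond_comp (ltW ki) ij).
  by have [-> _] := embP ij x.
move=> i0 U x /(embedding_openP qe)[V oV <-] /= Vx.
pose F := filter_from [set: I] (fun i => `[i, +oo[%classic).
have FF : ProperFilter F.
  apply: filter_from_proper; last by move=> i _; exists i; rewrite /= in_itv /= lexx.
  apply: filter_from_filter; first by exists i0.
  move=> i j _ _; exists (Order.max i j) => // k /=.
  by rewrite !in_itv /= !andbT ge_max => /andP.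
have cvF : (fun i => qX (lsec (q i x))) @ F --> qX x.
  apply/cvg_sup => j A /=.
  have /= -> := @nbhsE (initial_topology (fun f : prod_topology (fun i => S i) => f j)) (qX x).
  move=> [_ [[B oB <-] Bx] BA]; exists j => // i /=; rewrite in_itv /= andbT => ji.
  by apply: BA; rewrite /= /qX (q_lsec_le ji) bond_q.
have : F [set i | V (qX (lsec (q i x)))] by apply: cvF; exact: open_nbhs_nbhs.
by move=> /filter_ex[i Vi]; exists i.
Qed.

End Limit.

End CoherentSections.

(** * Separability of intervals inside images of spaces of the class *)

Lemma compact_metrizable_separable (R : realType) (X : topologicalType) :
  compact [set: X] -> metrizable R X ->
  exists2 D : set X, countable D & forall U, open U -> U !=set0 -> U `&` D !=set0.
Proof.
move=> cX [M [f [fe fr]]].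
have [[x0 _]|X0] := pselect ([set: X] !=set0); last first.
  by exists set0 => // U _ [x _]; case: X0; exists x.
pose M' : pseudoPMetricType R := HB.pack_for (pseudoPMetricType R) M
  (isPointed.Build M (f x0)).
have cM : compact [set: M'].
  rewrite -fr; apply: continuous_compact => //.
  by apply: continuous_subspaceT; exact: embedding_continuous.
have [B Bc [_ Bb]] := compact_second_countable cM.
(* One point of [X] is picked over each basic open set, with [x0] as the default when the preimage
   is empty. *)
have /choice[g gP] (b : set M') : exists x, (exists y, b (f y)) -> b (f x).
  have [[y by_]|nb] := pselect (exists y, b (f y)); first by exists y.
  by exists x0.
exists (g @` B); first exact: sub_countable (card_image_le _ _) Bc.
move=> _ /(embedding_openP fe)[V oV <-] [x /= Vx].
have : nbhs (f x : M') V by exact: open_nbhs_nbhs.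
move=> /Bb[b /= [Bb' bx] bV]; exists (g b); split; last by exists b.
by apply: bV; apply: gP; exists x.
Qed.

Lemma limit_continuous d (I : orderType d) (S : invsys I) (X : topologicalType)
    (q : forall i, X -> S i) (i : I) : is_limit q -> continuous (q i).
Proof.
move=> [qe _].
pose qX x : prod_topology (fun i => S i) := fun i => q i x.
rewrite (_ : q i = (fun f : prod_topology (fun i => S i) => f i) \o qX) //.
move=> x; apply: continuous_comp; last exact: continuous_coord.
exact: (embedding_continuous qe).
Qed.

(** The map [g] lets the induction run: a stage maps to [K] through its section followed by [g].
    Stages only reach a dense part of the range, so the slack [u < p] and [q < v] is what allows a
    single stage to reach beyond both ends. *)
Lemma class_R_separable (R : realType) (X : topologicalType) : class_R R X ->
  connected [set: X] -> forall d (K : orderTopologicalType d) (g : X -> K),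
  continuous g -> forall u v p q, range g u -> range g v -> u < p -> q < v ->
  separable_between p q.
Proof.
have cr (Y : topologicalType) d (K : orderTopologicalType d) (g : Y -> K) :
    connected [set: Y] -> continuous g -> connected (range g).
  move=> cY cg; apply: connected_continuous_connected => //.
  exact: continuous_subspaceT.
elim=> {X} [X cX mX conX d K g cg u v p q gu gv up qv|
    dI I S X qq wo Sc Sr _ IH qlim conX d K g cg u v p q gu gv up qv].
- have crg := cr _ _ _ _ conX cg.
  have [D Dc Dd] := compact_metrizable_separable cX mX.
  exists (g @` D); first exact: sub_countable (card_image_le _ _) Dc.
  move=> x y px xy yq.
  (* The range is convex and dense in itself, so the preimage of the gap is a nonempty open set and
     meets the dense set [D]. *)
  have gx : range g x.
    apply: (connected_convex crg gu gv).
    by rewrite (lt_le_trans up px) (lt_trans (lt_le_trans xy yq)).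
  have gy : range g y.
    apply: (connected_convex crg gu gv).
    by rewrite (le_lt_trans yq qv) (lt_trans (lt_le_trans up px)).
  have [_ [z _ <-] xzy] := connected_between crg gx gy xy.
  have [||c [xcy Dc']] := Dd (g @^-1` `]x, y[%classic).
  + by apply: (continuousP g).1 => //; exact: itv_open.
  + by exists z; rewrite /= in_itv /=.
  by exists (g c); [exists c | move: xcy; rewrite /= in_itv].
have [pq|qp] := leP p q; last first.
  exists set0 => // x y px xy yq.
  by have := le_lt_trans px (lt_le_trans xy yq); rewrite ltNge (ltW qp).
have crg := cr _ _ _ _ conX cg.
have gp : range g p.
  by apply: (connected_convex crg gu gv); rewrite up (le_lt_trans pq).
have gq : range g q.
  by apply: (connected_convex crg gu gv); rewrite qv (lt_le_trans up).
(* The limit of an empty sequence has at most one point, against [u < v]. *)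
have [[i0 _]|I0] := pselect ([set: I] !=set0); last first.
  have uv : u < v by exact: lt_trans up (le_lt_trans pq qv).
  move: gu gv uv => [x _ <-] [y _ <-].
  suff -> : x = y by rewrite ltxx.
  apply: qlim.1.1; apply: functional_extensionality_dep => i.
  by case: I0; exists i.
have [h [hc hK hS hd]] := limit_sections wo Sc Sr qlim.
have near x y : range g x -> range g y -> x < y ->
    exists i, exists2 w, range (g \o h i) w & x < w < y.
  move=> gx gy xy; have [_ [z _ <-] xzy] := connected_between crg gx gy xy.
  have [||i] := hd i0 (g @^-1` `]x, y[%classic) z.
  - by apply: (continuousP g).1 => //; exact: itv_open.
  - by rewrite /= in_itv /=.
  by rewrite /= in_itv /= => xw; exists i, (g (h i (qq i z))) => //; exists (qq i z).
(* One stage reaches a point below [p], another a point above [q]; as ranges increase, the later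
   stage [m] reaches both. *)
have [i [_ [x _ <-] /andP[_ xp]]] := near _ _ gu gp up.
have [j [_ [y _ <-] /andP[qy _]]] := near _ _ gq gv qv.
pose m := Order.max i j.
have im : i <= m by rewrite le_max lexx.
have jm : j <= m by rewrite le_max lexx orbT.
have conm : connected [set: S m].
  have <- : range (qq m) = [set: S m].
    by apply/seteqP; split=> // z _; exists (h m z); rewrite ?hK.
  apply: connected_continuous_connected => //.
  by apply: continuous_subspaceT; exact: limit_continuous.
apply: (IH m conm _ _ (g \o h m) _ (g (h i x)) (g (h j y))) => //.
- by move=> z; apply: continuous_comp; [exact: hc|exact: cg].
- by have [|z _ zx] := hS _ _ im (h i x); [exists x | exists z; rewrite //= zx].
- by have [|z _ zy] := hS _ _ jm (h j y); [exists y | exists z; rewrite //= zy].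
Qed.

(** * Classification *)

Section Dual.
Context d (L : orderType d).

(** An infimum is the supremum of the lower bounds. *)
Lemma order_complete_dual : order_complete L -> order_complete L^d.
Proof.
move=> Lc A; have [s sP] := Lc [set y : L | forall x, A x -> y <= x].
exists s => y; rewrite leEdual; split=> [ys x Ax|yA]; last first.
  by apply: (sP s).1 (lexx _) _ _.
by rewrite leEdual (le_trans ys) //; apply/sP => z; apply.
Qed.

Lemma order_dense_dual : order_dense L -> order_dense L^d.
Proof.
move=> Ld x y; rewrite ltEdual => /Ld[z /andP[yz zx]].
by exists z; rewrite !ltEdual zx.
Qed.

Lemma separable_dual (p q : L) :
  separable_between p q -> separable_between (q : L^d) p.
Proof.
move=> [C Cc Cd]; exists C => // x y; rewrite !leEdual ltEdual => xq yx py.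
by have [c Cc' /andP[yc cx]] := Cd _ _ py yx xq; exists c; rewrite // !ltEdual cx.
Qed.

End Dual.

Section Subinterval.
Context d (L : orderType d) (p q : L).
Hypothesis pq : p <= q.

Let J : set L := `[p, q]%classic.

Let Jp : p \in J. Proof. by rewrite inE /J /= in_itv /= lexx. Qed.

(** The monotone retraction onto the interval. It carries points and countable sets into the
    subtype, and later extends coordinates from a subinterval to the whole space. *)
Definition clamp (x : L) : J :=
  insubd (exist _ p Jp : J) (Order.max p (Order.min x q)).

Lemma val_clamp x : val (clamp x) = Order.max p (Order.min x q).
Proof.
rewrite /clamp val_insubd /=; case: ifPn => // /negP; case.
by rewrite inE /J /= in_itv /= le_max lexx /= ge_max pq ge_min lexx orbT.
Qed.

Lemma clamp_id x : p <= x <= q -> val (clamp x) = x.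
Proof. by move=> /andP[px xq]; rewrite val_clamp min_l // max_r. Qed.

Lemma itv_val (x : J) : p <= val x <= q.
Proof. by have := set_mem (valP x); rewrite /J /= in_itv. Qed.

Lemma clamp_val (x : J) : clamp (val x) = x.
Proof. by apply: val_inj; rewrite clamp_id // itv_val. Qed.

Lemma clamp_le x y : x <= y -> clamp x <= clamp y.
Proof.
move=> xy; rewrite le_set_type !val_clamp ge_max !le_max lexx /=.
by rewrite le_min !ge_min xy lexx /= !orbT.
Qed.

Lemma itv_order_complete : order_complete L -> order_complete J.
Proof.
(* Adding [p] keeps the supremum of the empty set inside the interval. *)
move=> Lc A; have [s sP] := Lc (p |` val @` A).
have ps : p <= s by apply: (sP s).1 (lexx _) _ _; left.
have sq : s <= q.
  by apply/sP => _ [->//|[x Ax <-]]; have /andP[] := itv_val x.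
exists (clamp s) => y; rewrite le_set_type clamp_id ?ps // sP; split=> yub x.
- by move=> Ax; rewrite le_set_type; apply: yub; right; exists x.
- by case=> [->|[z Az <-]]; [have /andP[] := itv_val y | rewrite -le_set_type; exact: yub].
Qed.

Lemma itv_order_dense : order_dense L -> order_dense J.
Proof.
move=> Ld x y; rewrite lt_set_type => /Ld[z /andP[xz zy]].
have /andP[px _] := itv_val x; have /andP[_ yq] := itv_val y.
exists (clamp z); rewrite !lt_set_type clamp_id ?xz //.
by rewrite (le_trans px (ltW xz)) (le_trans (ltW zy)).
Qed.

Lemma itv_separable (x y : J) :
  separable_between (val x) (val y) -> separable_between x y.
Proof.
move=> [C Cc Cd]; exists (clamp @` C).
  exact: sub_countable (card_image_le _ _) Cc.
move=> u v; rewrite !le_set_type lt_set_type => xu uv vy.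
have [c Cc' /andP[uc cv]] := Cd _ _ xu uv vy.
exists (clamp c); first by exists c.
rewrite !lt_set_type clamp_id ?uc //.
have /andP[pu _] := itv_val u; have /andP[_ vq] := itv_val v.
by rewrite (le_trans pu (ltW uc)) (le_trans (ltW cv)).
Qed.

End Subinterval.

Section UpperPart.
Context (R : realType) d (L : orderType d) (a b : L).
Hypotheses (Lc : order_complete L) (Ld : order_dense L).
Hypotheses (ab : a < b) (Lab : forall x, a <= x <= b).
Hypothesis Ls : forall p q, a < p -> q < b -> separable_between p q.

Let xb x : x <= b. Proof. by have /andP[] := Lab x. Qed.

(** Starting at [p] with [a < p] gives separability up to every [q < b], as the analysis of right
    ends demands; [clamp] and [val] carry cofinal sets between [L] and the interval. *)
Lemma upper_part (p : L) : a < p -> p < b ->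
  (countably_cofinal b -> order_iso `[p, b]%classic `[0%R : R, 1%R]%classic) /\
  (~ countably_cofinal b -> order_iso `[p, b]%classic (long_ray1 R)).
Proof.
move=> ap pb; have pb' := ltW pb.
set J : set L := `[p, b]%classic.
have Jc := itv_order_complete pb' Lc; have Jd := itv_order_dense pb' Ld.
pose P : J := clamp pb' p; pose B : J := clamp pb' b.
have vP : val P = p by rewrite clamp_id // lexx.
have vB : val B = b by rewrite clamp_id // lexx andbT.
have PB : P < B by rewrite lt_set_type vP vB.
have JPB x : P <= x <= B by rewrite !le_set_type vP vB itv_val.
have Js q : q < B -> separable_between P q.
  rewrite lt_set_type vB => qb; apply: (itv_separable pb'); rewrite vP.
  exact: Ls.
split=> [[C [Cc Cb Ccof]]|nc].
  apply: (order_iso_unit_interval R Jc Jd PB JPB Js).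
  exists (clamp pb' @` C); split.
  - exact: sub_countable (card_image_le _ _) Cc.
  - move=> _ [c /Cb cb <-].
    by rewrite lt_set_type vB val_clamp gt_max pb gt_min cb.
  - move=> x; rewrite lt_set_type vB => /Ccof[c Cc' xc].
    exists (clamp pb' c); first by exists c.
    by rewrite lt_set_type val_clamp lt_max lt_min xc (lt_le_trans xc (xb c)) orbT.
apply: (order_iso_long_ray1 R Jc Jd JPB Js) => -[C [Cc Cb Ccof]]; apply: nc.
exists (val @` C); split.
- exact: sub_countable (card_image_le _ _) Cc.
- by move=> _ [c /Cb + <-]; rewrite lt_set_type vB.
- move=> x xltb; have [|c Cc' xc] := Ccof (clamp pb' x).
    by rewrite lt_set_type vB val_clamp gt_max pb gt_min xltb.
  exists (val c); first by exists c.
  by move: xc; rewrite lt_set_type val_clamp gt_max gt_min => /andP[_ /orP[//|]]; rewrite ltNge xb.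
Qed.


End UpperPart.

Lemma order_iso_itv_dual d (L : orderType d) (a p : L) d' (M : orderType d') :
  order_iso `[p : L^d, a]%classic M -> order_iso (`[a, p]%classic : set L)^d M.
Proof.
have -> : `[p : L^d, a]%classic = (`[a, p]%classic : set L).
  by apply/seteqP; split=> x; rewrite /= !in_itv /= !leEdual andbC.
by move=> [f [bf fm]]; exists f; split=> // x y; rewrite fm.
Qed.

(** The four cases record whether [b], and [a] in the dual order, are countably cofinal. At such an
    end separability extends up to the end itself, so the analysis of right ends applies to all of
    [L] or of its dual. If neither end is of this kind, it applies on both sides of every interior
    point. *)
Lemma connected_order_classification (R : realType) d (L : orderType d) (a b : L) :
  order_complete L -> order_dense L -> a < b -> (forall x, a <= x <= b) ->
  (forall p q, a < p -> q < b -> separable_between p q) ->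
  [\/ order_iso L `[0%R : R, 1%R]%classic,
       order_iso L (long_ray1 R),
       order_iso L (long_ray1 R)^d | is_long_interval R L].
Proof.
move=> Lc Ld ab Lab Ls.
have Lcd := order_complete_dual Lc; have Ldd := order_dense_dual Ld.
have Labd (x : L^d) : (b : L^d) <= x <= a by rewrite !leEdual andbC.
have Lsd (p q : L^d) : (b : L^d) < p -> q < a -> separable_between p q.
  by rewrite !ltEdual => pb aq; apply: separable_dual; exact: Ls.
have [cb|ncb] := pselect (countably_cofinal b); last first.
  have [ca|nca] := pselect (countably_cofinal (a : L^d)).
    apply: Or42; apply: (order_iso_long_ray1 R Lc Ld Lab) => // q qb.
    apply: (@separable_dual _ L^d); apply: separable_of_cofinal => // p.
    by rewrite ltEdual => ap; apply: separable_dual; exact: Ls.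
  apply: Or44; exists a, b; split=> //; first by have [p] := Ld _ _ ab; exists p.
  move=> p /andP[ap pb]; split.
    exact: (upper_part R Lc Ld Lab Ls ap pb).2 ncb.
  apply: order_iso_dual; apply: order_iso_itv_dual.
  by apply: (upper_part R Lcd Ldd Labd Lsd _ _).2 nca; rewrite ltEdual.
have Lb p : a < p -> separable_between p b.
  by move=> ap; apply: separable_of_cofinal => // q; exact: Ls.
have [ca|nca] := pselect (countably_cofinal (a : L^d)).
  apply: Or41; apply: (order_iso_unit_interval R Lc Ld ab Lab) => // q _.
  have [C Cc Cd] : separable_between a b.
    apply: (@separable_dual _ L^d); apply: separable_of_cofinal => // p.
    by rewrite ltEdual => /Lb; exact: separable_dual.
  exists C => // x y ax xy _; apply: Cd => //.
  by have /andP[] := Lab y.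
apply: Or43; apply: order_iso_dual; apply: (order_iso_long_ray1 R Lcd Ldd Labd) => //.
by move=> q; rewrite ltEdual => /Lb; exact: separable_dual.
Qed.

(** * Valdivia compactness *)

Lemma countableU (T : Type) (A B : set T) :
  countable A -> countable B -> countable (A `|` B).
Proof.
move=> cA cB; have -> : (A `|` B)%classic = \bigcup_(b in [set: bool]) (if b then A else B).
  by apply/seteqP; split=> [x [Ax|Bx]|x [[] _]]; [exists true|exists false|left|right].
by apply: bigcup_countable => [|[]].
Qed.

Section RayFamily.
Context (R : realType).

(** Coordinates for one half of a Valdivia embedding. Monotonicity and surjectivity onto [[0, 1]]
    will give continuity; the last clause leaves only a greatest element free to have uncountably
    many nonzero coordinates. *)
Definition ray_family d (M : orderType d) := exists (A : Type) (f : A -> M -> R),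
  [/\ forall i x y, x <= y -> (f i x <= f i y)%R,
      forall i x, (0 <= f i x <= 1)%R,
      forall i r, (0 <= r <= 1)%R -> exists x, f i x = r,
      forall x y, x < y -> exists i, (f i x < f i y)%R
    & forall x y, x < y -> countable [set i | f i x != 0%R]].

Lemma ray_family_iso d (L : orderType d) d' (M : orderType d') :
  order_iso L M -> ray_family M -> ray_family L.
Proof.
move=> [g [[h hg gh] gm]] [A [f [fm f01 fo fs fc]]].
have glt : {mono g : x y / x < y} by exact: leW_mono.
exists A, (fun i => f i \o g); split=> [i x y xy|i x|i r /(fo i)[x <-]|x y xy|x y xy] /=.
- by apply: fm; rewrite gm.
- exact: f01.
- by exists (h x); rewrite gh.
- by apply: fs; rewrite glt.
- by apply: (fc _ (g y)); rewrite glt.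
Qed.

Lemma unit_interval_ray_family : ray_family `[0%R : R, 1%R]%classic.
Proof.
exists unit, (fun _ => val); split=> [_ x y|_ x|_ r r01|x y xy|x y _].
- by rewrite le_set_type.
- by have := set_mem (valP x); rewrite /= in_itv.
- have rI : r \in `[0%R : R, 1%R]%classic by rewrite inE /= in_itv.
  by exists (Sub r rI).
- by exists tt; rewrite -lt_set_type.
- exact: countableP.
Qed.

(** Coordinate [i] is [0] before the copy of [[0, 1[] with index [i], climbs along it, and is [1]
    afterwards. At a point of copy [j] only the countably many coordinates [i <= j] can be
    nonzero. *)
Lemma long_ray1_ray_family : ray_family (long_ray1 R).
Proof.
pose f (i : omega1) (x : long_ray1 R) : R :=
  if x is inl jt then if i < jt.1 then 1%R else if i == jt.1 then val jt.2 else 0%R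
  else 1%R.
have t01 (t : `[0%R : R, 1%R[%classic) : (0 <= val t < 1)%R.
  by have := set_mem (valP t); rewrite /= in_itv.
have f01 i x : (0 <= f i x <= 1)%R.
  case: x => [[j t]|u]; last by rewrite /= ler01 lexx.
  have /andP[t0 t1] := t01 t.
  by rewrite /f /=; case: ifP => _; [|case: ifP => _]; rewrite ?ler01 ?lexx ?t0 ?ltW.
have f1 i x : (f i x <= 1)%R by have /andP[] := f01 i x.
have f0 i x : (0 <= f i x)%R by have /andP[] := f01 i x.
exists omega1, f; split=> // [i x y|i r /andP[r0]|x y|x y].
- rewrite le_eqVlt => /predU1P[->//|]; rewrite lt_osum.
  case: x y => [[j t]|u] [[k t']|v] //=; last by move=> _; exact: (f1 i (inl (j, t))).
  rewrite ltEprodlexi /= => /andP[]; rewrite le_eqVlt => /predU1P[<-|jk].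
    rewrite lexx /= lt_set_type => tt'; rewrite /f /=.
    by case: ifP => // _; case: ifP => // _; exact: ltW.
  move=> _; have [ij|ji|->] := ltgtP i j.
  + by rewrite (lt_trans ij jk).
  + exact: (f0 i (inl (k, t'))).
  + by rewrite jk; have /andP[_ /ltW] := t01 t.
- rewrite le_eqVlt => /predU1P[->|r1]; first by exists (inr ord0).
  have rI : r \in `[0%R : R, 1%R[%classic by rewrite inE /= in_itv /= r0.
  by exists (inl (i, Sub r rI)); rewrite /f /= ltxx eqxx.
- rewrite lt_osum; case: x y => [[j t]|u] [[k t']|v] //=.
  + rewrite ltEprodlexi /= => /andP[]; rewrite le_eqVlt => /predU1P[<-|jk].
      rewrite lexx /= lt_set_type => tt'.
      by exists j; rewrite /f /= ltxx eqxx.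
    by move=> _; exists j; rewrite /f /= ltxx eqxx jk; have /andP[] := t01 t.
  + by move=> _; exists j; rewrite /f /= ltxx eqxx; have /andP[] := t01 t.
  + by rewrite (ord1 u) (ord1 v) ltxx.
- case: x => [[j t]|u]; last first.
    rewrite lt_osum; case: y => [//|v].
    by rewrite (ord1 u) (ord1 v) ltxx.
  move=> _; apply: (sub_countable _ (countableU (omega1_countable_below j) (countable1 j))).
  apply: subset_card_le => i /=; rewrite in_itv /f /=.
  by case: ltgtP => [ij _|_|-> _]; [left|rewrite eqxx|right].
Qed.

End RayFamily.

Section MonotoneContinuity.
Context (R : realType) d (K : orderTopologicalType d) (f : K -> R).
Hypothesis f01 : forall x, (0 <= f x <= 1)%R.
Hypothesis fonto : forall r, (0 <= r <= 1)%R -> exists x, f x = r.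

Lemma continuous_rays :
  (forall x r, (r < f x)%R -> nbhs x [set z | (r < f z)%R]) ->
  (forall x r, (f x < r)%R -> nbhs x [set z | (f z < r)%R]) -> continuous f.
Proof.
move=> hl hr x A /nbhs_ballP[e /= e0 eA].
have h1 := hl x (f x - e)%R (ltac:(by rewrite gtrBl)).
have h2 := hr x (f x + e)%R (ltac:(by rewrite ltrDl)).
apply: filterS (filterI h1 h2) => z [/= z1 z2]; apply: eA.
by rewrite /ball /= distrC ltr_distl z1.
Qed.

Let between_above x r : (r < f x)%R -> (0 <= r)%R ->
  exists y, (r < f y < f x)%R.
Proof.
move=> rx r0; have [|y fy] := fonto (r := ((r + f x) / 2)%R).
  by have /andP[? ?] := f01 x; apply/andP; split; lra.
by exists y; rewrite fy; apply/andP; split; lra.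
Qed.

Let between_below x r : (f x < r)%R -> (r <= 1)%R ->
  exists y, (f x < f y < r)%R.
Proof.
move=> rx r0; have [|y fy] := fonto (r := ((r + f x) / 2)%R).
  by have /andP[? ?] := f01 x; apply/andP; split; lra.
by exists y; rewrite fy; apply/andP; split; lra.
Qed.

(** A monotone map onto [[0, 1]] has no jumps: a value strictly between [r] and [f x] is attained at
    some [y], and the open ray from [y] containing [x] is the required neighbourhood. *)
Lemma nondecreasing_continuous :
  (forall x y, x <= y -> (f x <= f y)%R) -> continuous f.
Proof.
move=> fm; have flt x y : (f x < f y)%R -> x < y.
  by move=> xy; rewrite ltNge; apply/negP => /fm; rewrite leNgt xy.
apply: continuous_rays => x r rx.
- have [r0|r0] := ltP r 0%R.
    by apply: filterE => z /=; have /andP[z0 _] := f01 z; exact: lt_le_trans z0.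
  have [y /andP[ry yx]] := between_above rx r0.
  have : nbhs x `]y, +oo[%classic.
    by apply: open_nbhs_nbhs; split; [exact: rray_open | rewrite /= in_itv /= flt].
  by apply: filterS => z; rewrite /= in_itv /= andbT => /ltW/fm; exact: lt_le_trans.
- have [r1|r1] := ltP 1%R r.
    by apply: filterE => z /=; have /andP[_ z1] := f01 z; exact: le_lt_trans r1.
  have [y /andP[xy yr]] := between_below rx r1.
  have : nbhs x `]-oo, y[%classic.
    by apply: open_nbhs_nbhs; split; [exact: lray_open | rewrite /= in_itv /= flt].
  by apply: filterS => z; rewrite /= in_itv /= => /ltW/fm /le_lt_trans; apply.
Qed.

Lemma nonincreasing_continuous :
  (forall x y, x <= y -> (f y <= f x)%R) -> continuous f.
Proof.
move=> fm; have flt x y : (f x < f y)%R -> y < x.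
  by move=> xy; rewrite ltNge; apply/negP => /fm; rewrite leNgt xy.
apply: continuous_rays => x r rx.
- have [r0|r0] := ltP r 0%R.
    by apply: filterE => z /=; have /andP[z0 _] := f01 z; exact: lt_le_trans z0.
  have [y /andP[ry yx]] := between_above rx r0.
  have : nbhs x `]-oo, y[%classic.
    by apply: open_nbhs_nbhs; split; [exact: lray_open | rewrite /= in_itv /= flt].
  by apply: filterS => z; rewrite /= in_itv /= => /ltW/fm; exact: lt_le_trans.
- have [r1|r1] := ltP 1%R r.
    by apply: filterE => z /=; have /andP[_ z1] := f01 z; exact: le_lt_trans r1.
  have [y /andP[xy yr]] := between_below rx r1.
  have : nbhs x `]y, +oo[%classic.
    by apply: open_nbhs_nbhs; split; [exact: rray_open | rewrite /= in_itv /= flt].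
  by apply: filterS => z; rewrite /= in_itv /= andbT => /ltW/fm /le_lt_trans; apply.
Qed.

End MonotoneContinuity.

Lemma compact_embedding (X Y : topologicalType) (f : X -> Y) :
  compact [set: X] -> hausdorff_space Y -> continuous f -> injective f ->
  embedding f.
Proof.
move=> cX hY cf fi; split=> //; apply/seteqP; split=> U; last first.
  by move=> [V oV <-]; apply: (continuousP f).1.
move=> oU; exists (~` (f @` (~` U)))%classic.
  rewrite openC; apply: compact_closed => //; apply: continuous_compact.
    exact: continuous_subspaceT.
  by apply: (subclosed_compact _ cX) => //; exact: open_closedC.
apply/seteqP; split=> x /=; first by move=> h; apply: contrapT => nU; apply: h; exists x.
by move=> Ux [y nUy /fi yx]; apply: nUy; rewrite yx.
Qed.

(** The image is compact, hence closed, and so contains the closure of its part in the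
    Sigma-product; the last hypothesis makes that part dense in the image. *)
Lemma valdivia_family (R : realType) (X : topologicalType) (A : Type)
    (F : X -> {ptws A -> `[0%R : R, 1%R]%classic}) :
  compact [set: X] -> (forall i, continuous (fun x => val (F x i))) ->
  injective F ->
  (forall (x : X) (B : set X), nbhs x B -> exists2 z, B z & countable [set i | val (F z i) != 0%R]) ->
  valdivia R X.
Proof.
move=> cX cF Fi dF; split=> //; exists A, F.
have vale : embedding (val : `[0%R : R, 1%R]%classic -> R).
  by split=> //; exact: val_inj.
have hI : hausdorff_space (`[0%R : R, 1%R]%classic : topologicalType).
  exact: embedding_hausdorff vale (@Rhausdorff R).
have hY : hausdorff_space {ptws A -> `[0%R : R, 1%R]%classic}.
  exact: (@hausdorff_product {classic A}).
have cF' : continuous F.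
  apply: continuous_prod => i.
  exact: continuous_embedding vale _ _ (cF i).
split; first exact: compact_embedding.
have clF : closed (range F).
  apply: compact_closed => //; apply: continuous_compact => //.
  exact: continuous_subspaceT.
apply/seteqP; split=> y.
  by move=> h; apply: clF; apply: closureS h => z [].
move=> [x _ <-] B /cF'/dF[z Bz cz]; exists (F z); split=> //; split=> //; exists z.
Qed.

Section FinalValdivia.
Context (R : realType) d (K : orderTopologicalType d) (a b : K).
Hypotheses (cK : compact [set: K]) (conK : connected [set: K]).
Hypotheses (Kc : order_complete K) (Kd : order_dense K).
Hypotheses (ab : a < b) (Kab : forall x, a <= x <= b).
Hypothesis Ks : forall p q, a < p -> q < b -> separable_between p q.

Let upper_ray_family (e : K) : a < e -> e < b -> ray_family R `[e, b]%classic.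
Proof.
move=> ae eb; have [hi hl] := upper_part R Kc Kd Kab Ks ae eb.
have [/hi|/hl] := pselect (countably_cofinal b) => /ray_family_iso; apply.
- exact: unit_interval_ray_family.
- exact: long_ray1_ray_family.
Qed.

Let lower_ray_family (e : K) : a < e -> e < b ->
  ray_family R (`[a, e]%classic : set K)^d.
Proof.
move=> ae eb.
have Kabd (x : K^d) : (b : K^d) <= x <= a by rewrite !leEdual andbC.
have Ksd (p q : K^d) : (b : K^d) < p -> q < a -> separable_between p q.
  by rewrite !ltEdual => pb aq; apply: separable_dual; exact: Ks.
have [|//|hi hl] := upper_part R (order_complete_dual Kc) (order_dense_dual Kd) Kabd Ksd (p := e).
  by rewrite ltEdual.
have [/hi|/hl] := pselect (countably_cofinal (a : K^d)) =>
    /order_iso_itv_dual/ray_family_iso; apply.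
- exact: unit_interval_ray_family.
- exact: long_ray1_ray_family.
Qed.

(** The coordinates grow away from an interior point [e]: one family towards [b], and one, taken in
    the dual order, towards [a]. Interior points have countable support, and connectedness makes
    them dense. *)
Lemma connected_order_valdivia : valdivia R K.
Proof.
have [e /andP[ae eb]] := Kd ab.
have [A [f [fm f01 fo fs fc]]] := upper_ray_family ae eb.
have [B [g [gm g01 go gs gc]]] := lower_ray_family ae eb.
pose F (x : K) (i : A + B) : R := match i with
  | inl i => f i (clamp (ltW eb) x)
  | inr j => g j (clamp (ltW ae) x)
  end.
have F01 x i : F x i \in `[0%R : R, 1%R]%classic.
  by rewrite inE /= in_itv; case: i => i; [exact: f01|exact: g01].
pose G (x : K) : {ptws (A + B)%type -> `[0%R : R, 1%R]%classic} :=
  fun i => exist _ (F x i) (F01 x i).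
apply: (@valdivia_family R K (A + B)%type G cK).
- case=> i /=.
  + apply: (@nondecreasing_continuous R _ K) => [x|r r01|x y xy].
    * exact: f01.
    * by have [x <-] := fo i r r01; exists (val x); rewrite clamp_val.
    * by apply: fm; exact: clamp_le.
  + apply: (@nonincreasing_continuous R _ K) => [x|r r01|x y xy].
    * exact: g01.
    * by have [x <-] := go i r r01; exists (val x); rewrite clamp_val.
    * by apply: gm; rewrite leEdual; exact: clamp_le.
- have GF x y : G x = G y -> F x = F y.
    by move=> E; apply/funext => i; have := congr1 (fun h => val (h i)) E.
  suff lt x y : x < y -> G x <> G y.
    by move=> x y E; have [/lt|/lt/nesym|//] := ltgtP x y.
  (* When [y <= e] the left family separates the two points; otherwise their clamps to [[e, b]]
     differ and the right family does. *)
  move=> xy /GF FE; have [ye|ey] := leP y e.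
    have /gs[j] : (clamp (ltW ae) y : (`[a, e]%classic : set K)^d) < clamp (ltW ae) x.
      rewrite ltEdual lt_set_type !clamp_id //.
      * by have /andP[-> _] := Kab y.
      * by have /andP[-> _] := Kab x; rewrite (le_trans (ltW xy)).
    by have := congr1 (fun h => h (inr j)) FE; rewrite /F => ->; rewrite ltxx.
  have /fs[j] : clamp (ltW eb) x < clamp (ltW eb) y.
    have /andP[_ yb] := Kab y; have /andP[_ xb] := Kab x.
    by rewrite lt_set_type !val_clamp (min_l yb) (min_l xb) gt_max !lt_max ey xy !orbT.
  by have := congr1 (fun h => h (inl j)) FE; rewrite /F => ->; rewrite ltxx.
have interior_countable z : a < z -> z < b -> countable [set i | val (G z i) != 0%R].
  move=> az zb.
  apply: (sub_countable _ (countableU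
    (sub_countable (card_image_le (inl : A -> A + B)
       [set i | f i (clamp (ltW eb) z) != 0%R]) _)
    (sub_countable (card_image_le (inr : B -> A + B)
       [set i | g i (clamp (ltW ae) z) != 0%R]) _))).
  - by apply: subset_card_le => -[i|i] /= h; [left|right]; exists i.
  - apply: (fc _ (clamp (ltW eb) b)).
    by rewrite lt_set_type !val_clamp minxx (min_l (ltW zb)) gt_max !lt_max eb zb !orbT.
  - apply: (gc _ (clamp (ltW ae) a)).
    rewrite ltEdual lt_set_type !val_clamp (min_l (ltW ae)) maxxx.
    by rewrite lt_max lt_min az ae orbT.
move=> x U; rewrite nbhsE => -[V [oV Vx] VU].
suff [z Vz /andP[az zb]] : exists2 z, V z & a < z < b.
  by exists z; [exact: VU | exact: interior_countable].
(* An open set without interior points lies in [{a, b}]. Removing the endpoint [w] other than [x]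
   makes [{x}] open as well as closed, against connectedness. *)
apply: contrapT => nV.
have Vab z : V z -> z = a \/ z = b.
  move=> Vz; have /andP[az zb] := Kab z.
  have [->|za] := eqVneq z a; first by left.
  have [->|zb'] := eqVneq z b; first by right.
  by case: nV; exists z => //; rewrite !lt_neqAle eq_sym za az zb' zb.
have cl1 z : closed [set z : K].
  by apply: accessible_closed_set1; exact/hausdorff_accessible/order_hausdorff.
have one z : [set z] <> [set: K].
  move=> E; have : [set z] a /\ [set z] b by rewrite E.
  by move=> [/= az bz]; move: ab; rewrite az bz ltxx.
apply: (one x); apply: conK.
- by exists x.
- pose w := if x == a then b else a.
  exists (V `&` ~` [set w])%classic; first by apply: openI => //; rewrite openC; exact: cl1.
  rewrite setTI; apply/seteqP; split=> [_ ->|z [/Vab zab zw]].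
    split=> // /=; rewrite /w; case: eqP => [->|//] abE; move: ab; by rewrite abE ltxx.
  move: zw (Vab _ Vx); rewrite /w /=; case: eqP => [->|xa] zw xab.
    by case: zab.
  by case: xab => // ->; case: zab.
- by exists [set x]; [exact: cl1 | rewrite setTI].
Qed.

End FinalValdivia.

Theorem theorem5p2 (R : realType) (d : Order.disp_t)
    (K : orderTopologicalType d) :
  [set: K] !=set0 -> class_R R K -> connected [set: K] ->
  (order_iso K 'I_1 \/
   order_iso K `[0%R : R, 1%R]%classic \/
   order_iso K (long_ray1 R) \/
   order_iso K (long_ray1 R)^d \/
   exists (dL : Order.disp_t) (L : orderType dL),
     is_long_interval R L /\ order_iso K L) /\
  valdivia R K.
Proof.
move=> K0 KR conK; have [cK _] := class_R_compact_hausdorff KR.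
have Kc := compact_order_complete K0 cK.
have Kd : order_dense K.
  by move=> x y xy; have [z _] := connected_between conK I I xy; exists z.
(* The supremum of everything is the maximum, the supremum of the empty set the minimum. *)
have [b bP] := Kc setT; have [a aP] := Kc set0.
have Kab x : a <= x <= b.
  by rewrite (aP x).2 //= ((bP b).1 (lexx b)).
have [ab|ab] := eqVneq a b.
  have K1 x y : x = y :> K.
    have Ka z : z = a by have /andP[az zb] := Kab z; apply/le_anti; rewrite az ab zb.
    by rewrite (Ka x) (Ka y).
  split.
    left; exists (fun=> ord0); split; last by move=> x y; rewrite (K1 x y) !lexx.
    by exists (fun=> a) => x; [exact: K1 | rewrite (ord1 x)].
  (* A single point embeds in the cube with no coordinates. *)
  pose F (x : K) : {ptws False -> `[0%R : R, 1%R]%classic} := fun i => False_rect _ i.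
  apply: (@valdivia_family R K False F cK) => // x U xU.
  exists x; first exact: nbhs_singleton.
  by rewrite (_ : [set _ | _] = set0) //; apply/seteqP; split=> -[].
have {}ab : a < b by rewrite lt_neqAle ab; have /andP[] := Kab b.
have Ks p q : a < p -> q < b -> separable_between p q.
  move=> ap qb; have cid' : continuous (id : K -> K) by move=> x.
  by apply: (class_R_separable KR conK cid' _ _ ap qb); [exists a|exists b].
split; last exact: (connected_order_valdivia R cK conK Kc Kd ab Kab Ks).
have [|||] := connected_order_classification R Kc Kd ab Kab Ks.
- by right; left.
- by right; right; left.
- by right; right; right; left.
- move=> KL; do 4 right; exists d, K; split=> //.
  by exists id; split=> //; exists id.
Qed.
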